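(* Let $p$ be any prime, and let $G_1$ and $G_2$ be non-trivial pro-$p$ groups. The following assertions hold: (i) $G_1 \times G_2$ is a Frattini-resistant pro-$p$ group if and only if one of the groups $G_1$ or $G_2$ is torsion-free abelian and the other one is locally absolutely torsion-free, in which case $G_1 \times G_2$ is locally absolutely torsion-free. (ii) $G_1 \times G_2$ is a strongly Frattini-resistant pro-$p$ group if and only if one of the groups $G_1$ or $G_2$ is torsion-free abelian and the other one is absolutely torsion-free, in which case $G_1 \times G_2$ is absolutely torsion-free.
   Context: Conventions: for pro-$p$ groups all notions are topological: subgroups are closed, homomorphisms are continuous, and ''finitely generated'' means topologically finitely generated; commutator subgroups and subgroups of powers are the closed subgroups generated by the respective elements, and $H^{ab}=H/[H,H]$ with $[H,H]$ the closed commutator subgroup. For a pro-$p$ group $H$, the Frattini subgroup is $\Phi(H)=\overline{H^p[H,H]}$. For a pro-$p$ group $G$, let $\mathcal{S}(G)$ be the poset (under inclusion) of all closed subgroups of $G$ and $\mathcal{S}_{f.g.}(G)$ the subposet of all topologically finitely generated closed subgroups. $G$ is Frattini-resistant if for all $H,K\in\mathcal{S}_{f.g.}(G)$: $\Phi(H)\le\Phi(K)\Leftrightarrow H\le K$. $G$ is strongly Frattini-resistant if for all $H,K\in\mathcal{S}(G)$: $\Phi(H)\le\Phi(K)\Leftrightarrow H\le K$. $G$ is absolutely torsion-free if $H^{ab}$ is torsion-free for every closed subgroup $H$ of $G$. $G$ is locally absolutely torsion-free if $H^{ab}$ is torsion-free for every topologically finitely generated closed subgroup $H$ of $G$ (equivalently,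 every topologically finitely generated closed subgroup of $G$ is absolutely torsion-free). *)

(* Defs.v *)
From HB Require Import structures.
From mathcomp Require Import all_boot.
From mathcomp Require Import boolp classical_sets functions cardinality filter.
From mathcomp Require Import topology.

Set Implicit Arguments.
Unset Strict Implicit.
Unset Printing Implicit Defensive.

Local Open Scope classical_set_scope.
Local Open Scope group_scope.

HB.mixin Record Group_Topological_isTopologicalGroup G
    of Group G & Topological G := {
  mulg_continuous : continuous (fun xy : G * G => xy.1 * xy.2);
  invg_continuous : continuous (fun x : G => x^-1)
}.

#[short(type="topGroupType")]
HB.structure Definition TopologicalGroup :=
  {G of Group G & Topological G & Group_Topological_isTopologicalGroup G}.

Section GroupDefs.
Variable G : groupType.
Implicit Types (H N : set G) (x y : G).

Definition is_subgroup H : Prop :=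
  [/\ H 1, forall x y, H x -> H y -> H (x * y) & forall x, H x -> H x^-1].

Definition is_normal N : Prop := forall x y, N x -> N (x ^ y).

Definition lcoset_set N x : set G := [set x * y | y in N].

Definition has_index N (n : nat) : Prop :=
  (range (lcoset_set N) #= `I_n)%card.

Definition nontrivial_group : Prop := exists x : G, x <> 1.

Definition abelian_group : Prop := forall x y, x * y = y * x.

Definition torsion_free_group : Prop :=
  forall x (n : nat), (0 < n)%N -> x ^+ n = 1 -> x = 1.

(* The group H / N is torsion-free, for N normal in H: its elements are the
   cosets x N with x in H, its identity is 1 N, and (x N)^n = x^n N. *)
Definition torsion_free_quotient H N : Prop :=
  forall x (n : nat), H x -> (0 < n)%N ->
    lcoset_set N (x ^+ n) = lcoset_set N 1 -> lcoset_set N x = lcoset_set N 1.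

End GroupDefs.

(* A profinite group is a compact Hausdorff group in which the open subgroups
   form a base of neighbourhoods of 1; it is pro-p if each of its open normal
   subgroups has index a power of p (Dixon, du Sautoy, Mann, Segal,
   "Analytic pro-p groups", Definitions 1.1 and 1.10). *)
HB.mixin Record TopologicalGroup_isProP (p : nat) G of TopologicalGroup G := {
  prop_compact : compact [set: G];
  prop_hausdorff : hausdorff_space G;
  prop_open_subgroup_base : forall U : set G, nbhs (1 : G) U ->
    exists H : set G, [/\ open H, is_subgroup H & H `<=` U];
  prop_index : forall N : set G, open N -> is_subgroup N -> is_normal N ->
    exists k : nat, has_index N (p ^ k)
}.

#[short(type="proPGroupType")]
HB.structure Definition ProPGroup (p : nat) :=
  {G of TopologicalGroup G & TopologicalGroup_isProP p G}.

Section TopGroupDefs.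
Variable G : topGroupType.
Implicit Types H K A : set G.

Definition closed_subgroup H : Prop := closed H /\ is_subgroup H.

Definition closed_gen A : set G := smallest closed_subgroup A.

Definition top_fg H : Prop := exists2 A : set G, finite_set A & H = closed_gen A.

Definition derived_subgroup H : set G :=
  closed_gen [set [~ x, y] | x in H & y in H].

Definition power_subgroup (p : nat) H : set G :=
  closed_gen [set x ^+ p | x in H].

Definition frattini (p : nat) H : set G :=
  closure [set x * y | x in power_subgroup p H & y in derived_subgroup H].

End TopGroupDefs.

Section ProPDefs.
Variables (p : nat) (G : proPGroupType p).

Definition frattini_resistant : Prop :=
  forall H K : set G, closed_subgroup H -> closed_subgroup K ->
    top_fg H -> top_fg K -> (frattini p H `<=` frattini p K <-> H `<=` K).

Definition strongly_frattini_resistant : Prop :=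
  forall H K : set G, closed_subgroup H -> closed_subgroup K ->
    (frattini p H `<=` frattini p K <-> H `<=` K).

Definition absolutely_torsion_free : Prop :=
  forall H : set G, closed_subgroup H ->
    torsion_free_quotient H (derived_subgroup H).

Definition locally_absolutely_torsion_free : Prop :=
  forall H : set G, closed_subgroup H -> top_fg H ->
    torsion_free_quotient H (derived_subgroup H).

End ProPDefs.

Section ProductTopologicalGroup.
Variables G H : topGroupType.

Lemma pair_mulg_continuous :
  continuous (fun xy : ((G * H) * (G * H))%type => xy.1 * xy.2).
Proof.
move=> [[a b] [c d]]; apply: cvg_pair => /=.
- apply: (@continuous2_cvg _ G G G _ _ (fun z => z.1.1) (fun z => z.2.1)
    (fun x y => x * y) a c).
  + exact: (@mulg_continuous G (a, c)).
  + by apply: cvg_comp; [exact: cvg_fst | exact: cvg_fst].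
  + by apply: cvg_comp; [exact: cvg_snd | exact: cvg_fst].
- apply: (@continuous2_cvg _ H H H _ _ (fun z => z.1.2) (fun z => z.2.2)
    (fun x y => x * y) b d).
  + exact: (@mulg_continuous H (b, d)).
  + by apply: cvg_comp; [exact: cvg_fst | exact: cvg_snd].
  + by apply: cvg_comp; [exact: cvg_snd | exact: cvg_snd].
Qed.

Lemma pair_invg_continuous : continuous (fun x : (G * H)%type => x^-1).
Proof.
move=> [a b]; apply: cvg_pair => /=.
- by apply: cvg_comp; [exact: cvg_fst | exact: (@invg_continuous G a)].
- by apply: cvg_comp; [exact: cvg_snd | exact: (@invg_continuous H b)].
Qed.

HB.instance Definition _ :=
  Group_Topological_isTopologicalGroup.Build (G * H)%type
    pair_mulg_continuous pair_invg_continuous.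

End ProductTopologicalGroup.

Section PairGroup.
Variables G H : groupType.

Lemma mulg_pairE (a c : G) (b d : H) : (a, b) * (c, d) = (a * c, b * d).
Proof. by []. Qed.

Lemma invg_pairE (a : G) (b : H) : (a, b)^-1 = (a^-1, b^-1).
Proof. by []. Qed.

End PairGroup.

Section Cosets.
Variable G : groupType.
Implicit Types (N : set G) (x y : G).

Lemma lcoset_set_eqP N x y : is_subgroup N ->
  lcoset_set N x = lcoset_set N y <-> N (x^-1 * y).
Proof.
move=> [N1 NM NV]; split=> [E|Nxy].
  have: lcoset_set N x y by rewrite E; exists 1; rewrite // mulg1.
  by move=> [z Nz <-]; rewrite mulgA mulVg mul1g.
apply/seteqP; split=> _ [z Nz <-].
  exists (y^-1 * x * z); first by apply: NM => //; move/NV: Nxy; rewrite invgM invgK.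
  by rewrite !mulgA mulgV mul1g.
exists (x^-1 * y * z); first exact: NM.
by rewrite !mulgA mulgV mul1g.
Qed.

(* n is the index of N iff some t_0, ..., t_(n-1) form a transversal of N. *)
Lemma has_indexP N (n : nat) : is_subgroup N ->
  has_index N n <-> exists2 t : nat -> G,
    (forall x, exists2 i, (i < n)%N & N ((t i)^-1 * x)) &
    (forall i j, (i < n)%N -> (j < n)%N -> N ((t i)^-1 * t j) -> i = j).
Proof.
move=> sN; split=> [|[t tS tI]].
  rewrite /has_index card_eq_sym => /card_set_bijP[f [fF fI fS]].
  have /choice[t tE] : forall i, exists x, (i < n)%N -> f i = lcoset_set N x.
    move=> i; case: (ltnP i n) => [lin|_]; last by exists 1.
    by have [x _ <-] := fF i lin; exists x.
  exists t => [x|i j lin ljn /(lcoset_set_eqP _ _ sN)].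
    have [i lin fi] := fS (lcoset_set N x) (ex_intro2 _ _ x I erefl).
    by exists i => //; apply/(lcoset_set_eqP _ _ sN); rewrite -tE.
  by rewrite -!tE //; apply: fI; apply/mem_set.
rewrite /has_index card_eq_sym; apply/card_set_bijP.
exists (fun i => lcoset_set N (t i)); split.
- by move=> i _; exists (t i).
- move=> i j /set_mem lin /set_mem ljn /(lcoset_set_eqP _ _ sN).
  exact: tI.
- move=> _ [x _ <-]; have [i lin Ni] := tS x.
  by exists i => //; apply/(lcoset_set_eqP _ _ sN).
Qed.

End Cosets.

Section ProductProPGroup.
Variables (p : nat) (G H : proPGroupType p).

Lemma pair_prop_compact : compact [set: (G * H)%type].
Proof.
by rewrite -setXTT; apply: compact_setX; exact: prop_compact.
Qed.

Lemma pair_prop_hausdorff : hausdorff_space (G * H)%type.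
Proof.
move=> [a b] [c d] cl; congr pair.
- apply: (@prop_hausdorff p G) => A B nA nB.
  have := cl (A `*` setT) (B `*` setT).
  case.
  + by exists (A, setT) => //; split=> //; exact: filterT.
  + by exists (B, setT) => //; split=> //; exact: filterT.
  + by move=> [x y] [[/= Ax _] [/= Bx _]]; exists x.
- apply: (@prop_hausdorff p H) => A B nA nB.
  have := cl (setT `*` A) (setT `*` B).
  case.
  + by exists (setT, A) => //; split=> //; exact: filterT.
  + by exists (setT, B) => //; split=> //; exact: filterT.
  + by move=> [x y] [[/= _ Ay] [/= _ By]]; exists y.
Qed.

Lemma pair_prop_open_subgroup_base (U : set (G * H)%type) :
  nbhs (1 : (G * H)%type) U ->
  exists K : set (G * H)%type, [/\ open K, is_subgroup K & K `<=` U].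
Proof.
move=> [[A B] [/= nA nB] sAB].
have [K [oK [K1 KM KV] sKA]] := @prop_open_subgroup_base p G A nA.
have [L [oL [L1 LM LV] sLB]] := @prop_open_subgroup_base p H B nB.
exists (K `*` L); split.
- rewrite openE => -[x y] [/= Kx Ly]; exists (K, L) => //=.
  by split; exact: open_nbhs_nbhs.
- split=> //.
  + by move=> x y [Kx Lx] [Ky Ly]; split; [exact: KM | exact: LM].
  + by move=> x [Kx Lx]; split; [exact: KV | exact: LV].
- by move=> x [Kx Lx]; apply: sAB; split; [exact: sKA | exact: sLB].
Qed.

Lemma pair_prop_index (N : set (G * H)%type) :
  open N -> is_subgroup N -> is_normal N -> exists k : nat, has_index N (p ^ k).
Proof.
move=> oN sN nN; have [N1 NM NV] := sN.
pose A : set G := [set x | N (x, 1)].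
pose B : set H := [set y | exists x, N (x, y)].
have sA : is_subgroup A.
  split=> // [x y Ax Ay|x Ax]; rewrite /A /=.
    by have := NM _ _ Ax Ay; rewrite mulg_pairE mulg1.
  by have := NV _ Ax; rewrite invg_pairE invg1.
have sB : is_subgroup B.
  split=> [|x y [u Nu] [v Nv]|x [u Nu]]; first by exists 1.
    by exists (u * v); exact: (NM _ _ Nu Nv).
  by exists u^-1; exact: (NV _ Nu).
have [a /has_indexP-/(_ sA)[t tS tI]] : exists k, has_index A (p ^ k).
  apply: (@prop_index p G) => //.
    apply: (@open_comp _ _ (fun x : G => (x, 1 : H))) => // x _.
    by apply: cvg_pair => //=; exact: cvg_cst.
  move=> x y Ax; rewrite /A /=.
  by have := nN _ (y, 1) Ax; rewrite /conjg invg_pairE !mulg_pairE invg1 !mulg1.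
have [b /has_indexP-/(_ sB)[s sS sI]] : exists k, has_index B (p ^ k).
  apply: (@prop_index p H) => //.
    have -> : B = \bigcup_(x in [set: G]) [set y | N (x, y)].
      by apply/seteqP; split=> y [x]; [exists x | move=> _ ?; exists x].
    apply: bigcup_open => x _.
    apply: (@open_comp _ _ (fun y : H => (x, y))) => // y _.
    by apply: cvg_pair => //=; exact: cvg_cst.
  by move=> x y [u Nu]; exists (u ^ 1); exact: (nN _ (1, y) Nu).
have pb_gt0 : (0 < p ^ b)%N.
  by have [i lti _] := sS 1; exact: leq_ltn_trans lti.
exists (a + b)%N; apply/has_indexP => //.
exists (fun n => (t (n %/ p ^ b)%N, s (n %% p ^ b)%N)).
  move=> [x y].
  have [j ltj [u Nu]] := sS y.
  have [i lti Ai] := tS (x * u^-1).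
  exists (i * p ^ b + j)%N.
    rewrite expnD (@leq_trans (i.+1 * p ^ b)) ?leq_mul2r ?lti ?orbT//.
    by rewrite mulSn addnC ltn_add2r.
  rewrite divnMDl// (divn_small ltj) addn0 modnMDl (modn_small ltj).
  have := NM _ _ Ai Nu.
  by rewrite !invg_pairE !mulg_pairE mul1g -!mulgA mulVg mulg1.
move=> i j; rewrite !expnD => lti ltj Nij.
have Er : (i %% p ^ b = j %% p ^ b)%N.
  by apply: sI; rewrite ?ltn_mod//; exists ((t (i %/ p ^ b)%N)^-1 * t (j %/ p ^ b)%N).
rewrite (divn_eq i (p ^ b)) (divn_eq j (p ^ b)) Er; congr (_ * _ + _)%N.
apply: tI; rewrite ?ltn_divLR//.
by move: Nij; rewrite Er invg_pairE mulg_pairE mulVg.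
Qed.

HB.instance Definition _ :=
  TopologicalGroup_isProP.Build p (G * H)%type pair_prop_compact
    pair_prop_hausdorff pair_prop_open_subgroup_base pair_prop_index.

End ProductProPGroup.

(* Main.v *)
(** A subgroup [K] satisfies [Phi(K) = { k^p d | k in K, d in [K, K] }], so (strong)
    Frattini-resistance means that [x^p] in [Phi(K)] forces [x] in [K].  If all
    abelianizations are torsion-free, then [x^p = k^p d] puts [k^-1 x] in the
    derived subgroup of [<K, x>], and [x] is in [K] because [Phi(<K, x>)] consists of
    non-generators; a torsion-free abelian factor does not create torsion in
    abelianizations.

    Conversely let [G1 * G2] be resistant.  Given [z <> 1] in [G1] and [H <= G2]
    with [x^p] in [[H, H]] but [x] not in [[H, H]], choose a character [e] of
    a finite quotient of [H] with values in [Z/p^k] and [e(x) <> 0].  The subgroup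
    generated by the [(z^e(h), h)] has derived subgroup [1 * [H, H]], which contains
    [(1, x)^p], but it does not contain [(1, x)].

    If [[a, b] <> 1] in [G1] and [[c, d] <> 1] in [G2], let [K] be generated by
    [(a, c)], [(b, d)] and [(a^p, 1)].  Then
    [(a^b, c)^p = (a, c)^p [(a^p, 1), (b, d)]] is in [Phi(K)], hence [(a^b, c)] and
    [([a, b], 1)] are in [K].  But by torsion-freeness of [<a, b>^ab], [[a, b]] is not
    in the closed set of all [u^p v^p t] with [u], [v] in the closures of [<a>], [<b>]
    and [t] in [T^p [T, <a, b>]], [T = [<a, b>, <a, b>]]; hence [<a, b>] maps onto
    a group in which [a] and [b] have order [p] and [[a, b] <> 1] is central, and so
    does [<c, d>].  This separates [([a, b], 1)] from [K]. *)

Require Import Defs.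
From mathcomp Require Import all_boot boolp classical_sets cardinality topology.
From mathcomp Require Import fintype finset fingroup morphism perm quotient.
From mathcomp Require Import gproduct cyclic commutator gfunctor center pgroup.
From mathcomp Require Import nilpotent sylow abelian maximal classfun character.

Set Implicit Arguments.
Unset Strict Implicit.
Unset Printing Implicit Defensive.

Local Open Scope group_scope.

(** * Finite p-groups *)

Section FinitePGroups.
Variable p : nat.

Lemma pgroup_mem_der1_nongen (gT : finGroupType) (P K : {group gT}) x :
  p.-group P -> P :=: <<x |: K>> -> x \in K * P^`(1) -> x \in K.
Proof.
move=> pP defP xK.
have sKP : K \subset P by rewrite defP sub_gen ?subsetUr.
suff /subsetP sPK : P \subset K by apply: sPK; rewrite defP mem_gen ?setU11.
rewrite -[K : {set _}]genGid (@Phi_nongen _ P K) //.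
apply/eqP; rewrite eqEsubset join_subG Phi_sub sKP /= {1}defP gen_subG.
have sdP : P^`(1) \subset 'Phi(P) by rewrite (Phi_joing pP) joing_subl.
apply/subsetP=> y /setU1P[->|Ky]; last by rewrite mem_gen // inE Ky orbT.
case/mulsgP: xK => k d Kk P'd ->.
by rewrite groupM ?mem_gen // inE ?Kk ?(subsetP sdP _ P'd) ?orbT.
Qed.

(** Taking powers is multiplicative in the abelian quotient P/P'. *)
Lemma der1_expM (gT : finGroupType) (P : {group gT}) x y n :
  x \in P -> y \in P -> (x ^+ n * y ^+ n)^-1 * (x * y) ^+ n \in P^`(1).
Proof.
move=> Px Py; have nP := subsetP (der_norm 1 P).
apply: coset_idr; first by rewrite nP ?(groupM, groupV, groupX).
rewrite !(morphM, morphV, morphX) /= ?nP ?(groupM, groupV, groupX) //.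
rewrite expgMn ?mulVg //; apply: (centsP (der_abelian 0 P)); exact: mem_quotient.
Qed.

(** As [m] is invertible modulo the order of [x], [x] is a power of [x ^+ m]. *)
Lemma pgroup_coprime_root (gT : finGroupType) (K : {group gT}) x m :
  p.-elt x -> coprime p m -> x ^+ m \in K -> x \in K.
Proof.
move=> px cpm Kx; have com : coprime #|<[x]>| m.
  by rewrite -[#|_|]/#[x]; have /p_natP[k ->] := px; exact: coprimeXl.
by rewrite -(expgK com (cycle_id x)) groupX.
Qed.

(** P' is the intersection of the kernels of the linear characters, so one of them does not kill
    [x]. Its center is all of [P], and the center of an irreducible character is cyclic modulo the
    kernel. *)
Lemma cyclic_quotient_separates (gT : finGroupType) (P : {group gT}) x :
  x \in P -> x \notin P^`(1) ->
  exists N : {group gT}, [/\ N <| P, cyclic (P / N) & x \notin N].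
Proof.
move=> Px; rewrite -cap_cfker_lin_irr => /bigcapP xP.
have [i /andP[lin xi]] : exists i,
    ('chi[P]_i \is a linear_char)%R && (x \notin cfker ('chi_i)%R).
  apply/existsP; apply: contra_notT xP => /existsPn xP i lin.
  by have := xP i; rewrite lin /= negbK.
exists (cfker_group ('chi_i)%R); split=> //; first exact: cfker_normal.
have := cfcenter_cyclic ('chi_i)%R; congr (cyclic (_ / _)).
apply/eqP; rewrite eqEsubset cfcenter_sub /=; apply/subsetP=> y Py.
by rewrite irr_cfcenterE // (normC_lin_char lin) // (lin_char1 lin).
Qed.

Lemma pgroup_character_mod (gT : finGroupType) (P : {group gT}) x :
  p.-group P -> x \in P -> x \notin P^`(1) ->
  exists k (e : gT -> nat),
    {in P &, forall y z, e (y * z) = e y + e z %[mod p ^ k]} /\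
    ~~ (p ^ k %| e x).
Proof.
move=> pP Px /(cyclic_quotient_separates Px)[N [nNP /cyclicP[g defg] Nx]].
have /p_natP[k gk] : p.-nat #[g].
  by rewrite [#[g]]/= /order -defg; exact: quotient_pgroup.
(* The default 0 is never reached on [P]. *)
pose e y :=
  if [pick i : 'I_#[g] | g ^+ i == coset N y] is Some i then i : nat else 0%N.
have eP y : y \in P -> g ^+ e y = coset N y.
  move=> Py; rewrite /e; case: pickP => [i /eqP //|none].
  have : coset N y \in <[g]> by rewrite -defg mem_quotient.
  by case/cyclePmin=> i lti cy; have := none (Ordinal lti); rewrite /= cy eqxx.
have nN := subsetP (normal_norm nNP).
exists k, e; rewrite -gk; split=> [y z Py Pz|].
  apply/eqP; rewrite -eq_expg_mod_order expgD !eP ?groupM //.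
  by rewrite morphM ?nN.
by rewrite order_dvdn eP //; apply: contra Nx => /eqP /coset_idr ->; rewrite ?nN.
Qed.

(** Modulo [D] the two generators commute, so P/D is abelian. *)
Lemma der1_sub_gen2 (gT : finGroupType) (P D : {group gT}) x y :
    P :=: <<[set x; y]>> -> P \subset 'N(D) -> [~ x, y] \in D ->
  P^`(1) \subset D.
Proof.
move=> defP nDP Dxy; apply: der1_min => //; rewrite defP.
have nDxy : [set x; y] \subset 'N(D) by rewrite -gen_subG -defP.
have [nDx nDy] : x \in 'N(D) /\ y \in 'N(D).
  by split; apply: (subsetP nDxy); rewrite !inE eqxx ?orbT.
rewrite quotient_gen // abelian_gen quotientU !quotient_set1 //.
have cxy : commute (coset D x) (coset D y).
  by apply/commgP; rewrite -morphR //= coset_id.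
apply/subsetP=> a aA; apply/centP=> b bA.
by move: aA bA => /set2P[]-> /set2P[]->; rewrite /commute// -cxy.
Qed.

(** [L] is the graph of h -> z^(e h), thickened by the powers of [z ^+ n] because [e] is additive
    only modulo [n]. Over first coordinate 1 the exponents are multiples of the order of [z], hence
    of [n]. *)
Lemma character_graph (gT1 gT2 : finGroupType) (P : {group gT2})
    (n : nat) (e : gT2 -> nat) (z : gT1) :
    {in P &, forall h h', e (h * h') = e h + e h' %[mod n]} -> n %| #[z] ->
  exists L : {group gT1 * gT2},
    {in P, forall h, (z ^+ e h, h) \in L} /\
    (forall h, (1, h) \in L -> n %| e h).
Proof.
move=> eM nz; pose L := [set u : gT1 * gT2 | (u.2 \in P) &&
  [exists m : 'I_#[z], (u.1 == z ^+ m) && (m == e u.2 %[mod n])]].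
have LP u : reflect
    (u.2 \in P /\ exists2 m : nat, u.1 = z ^+ m & m = e u.2 %[mod n]) (u \in L).
  rewrite inE; apply: (iffP andP) => [[Pu /existsP[m /andP[/eqP u1 /eqP u2]]]|].
    by split=> //; exists m.
  case=> Pu [m u1 u2]; split=> //; apply/existsP.
  exists (Ordinal (ltn_pmod m (order_gt0 z))).
  by rewrite /= u1 -expg_mod_order eqxx /= modn_dvdm // u2.
have gL : group_set L.
  apply/group_setP; split=> [|u v /LP[Pu [m u1 u2]] /LP[Pv [m' v1 v2]]].
    apply/LP; split; rewrite /= ?group1 //; exists 0%N; rewrite ?expg0 //.
    have /eqP := eM 1 1 (group1 P) (group1 P).
    by rewrite mulg1 -{1}[e 1]addn0 eqn_modDl => /eqP.
  apply/LP; split; first by rewrite groupM.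
  exists (m + m')%N; first by rewrite expgD -u1 -v1.
  by rewrite eM // -modnDm u2 v2 modnDm.
exists (Group gL); split=> [h Ph|h]; first by apply/LP; split=> //; exists (e h).
case/LP=> _ [m /= /esym/eqP zm hm].
by rewrite /dvdn -hm -/(n %| m) (dvdn_trans nz) // order_dvdn.
Qed.

(** This is P'^p [P', P]; modulo it P' is central of exponent dividing [p]. It is given by
    generators so that images of its topological counterpart can be matched generator by
    generator. *)
Definition der_frattini (gT : finGroupType) (P : {set gT}) : {set gT} :=
  <<[set t ^+ p | t in P^`(1)] :|: commg_set P^`(1) P>>.

Canonical der_frattini_group (gT : finGroupType) (P : {set gT}) :=
  Eval hnf in [group of der_frattini P].

(** * The subgroup P'^p [P', P] and Heisenberg-type quotients *)

Section DerFrattini.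
Variables (gT : finGroupType) (P : {group gT}).
Hypothesis pP : p.-group P.

Let pP' : p.-group P^`(1) := pgroupS (der_sub 1 P) pP.

Lemma der_frattiniE : der_frattini P = 'Mho^1(P^`(1)) <*> [~: P^`(1), P].
Proof.
rewrite (MhoE 1 pP') expn1 /der_frattini /commutator joing_idl joing_idr.
by [].
Qed.

Lemma der_frattini_normal : der_frattini P <| P.
Proof.
rewrite der_frattiniE normalY //.
  exact: gFnormal_trans (der_normal 1 P).
rewrite /normal commg_normr andbT.
by rewrite comm_subG ?der_sub.
Qed.

Lemma der_frattini_mem_exp t : t \in P^`(1) -> t ^+ p \in der_frattini P.
Proof. by move=> P't; apply/mem_gen/setUP; left; apply: imset_f. Qed.

Lemma der_frattini_mem_comm t u :
  t \in P^`(1) -> u \in P -> [~ t, u] \in der_frattini P.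
Proof. by move=> P't Pu; apply/mem_gen/setUP; right; apply: imset2_f. Qed.

(** The hypothesis puts P' inside P'^p [P', P]. The p-th powers are non-generators of P', so P' =
    [P', P], and nilpotence forces P' = 1. *)
Lemma der_frattini_collapse x y :
  P :=: <<[set x; y]>> -> [~ x, y] \in der_frattini P -> [~ x, y] = 1.
Proof.
move=> defP xyD.
have [Px Py] : x \in P /\ y \in P by rewrite defP !mem_gen ?inE ?eqxx ?orbT.
have nDP := normal_norm der_frattini_normal.
have sP'D : P^`(1) \subset der_frattini P by exact: der1_sub_gen2 defP nDP _.
have : P^`(1) :==: 1.
  apply/negPn/negP=> ntP'.
  have := nil_comm_properl (pgroup_nil pP) (der_sub 1 P) ntP' (A := P).
  rewrite subsetI subxx normal_norm ?der_normal// properE => /(_ isT).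
  case/andP=> _ /negP[].
  rewrite -[[~: _, _]]genGid (@Phi_nongen _ [group of P^`(1)]) //.
  apply/eqP; rewrite eqEsubset join_subG Phi_sub /= commg_subl.
  rewrite normal_norm ?der_normal//= (subset_trans sP'D)// der_frattiniE.
  by rewrite genS // setSU // (Phi_joing pP') joing_subr.
move/eqP=> P'1; apply/set1gP; rewrite -P'1.
exact: mem_commg.
Qed.

(* Modulo [der_frattini P], [s] is central with [s^p = 1], so that
   [u^p (u^-1 s)^p] vanishes. *)
Lemma der_frattini_exp_collapse x y u s r :
    P :=: <<[set x; y]>> -> u \in P -> s \in P^`(1) -> r \in der_frattini P ->
  [~ x, y] = u ^+ p * (u^-1 * s) ^+ p * r -> [~ x, y] = 1.
Proof.
move=> defP Pu P's Dr def; apply: der_frattini_collapse => //.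
have nD := subsetP (normal_norm der_frattini_normal).
have Ps := subsetP (der_sub 1 P) s P's.
rewrite def groupMr //; apply: coset_idr.
  by rewrite nD ?(groupM, groupX, groupV).
rewrite !(morphM, morphX, morphV) /= ?nD ?(groupM, groupX, groupV) //.
have cus : commute (coset (der_frattini P) s) (coset (der_frattini P) u).
  apply/commgP; rewrite -morphR ?nD//=.
  by apply/eqP/coset_id; exact: der_frattini_mem_comm.
rewrite expgMn; last exact/commute_sym/commuteV.
rewrite expgVn mulgA mulgV mul1g -morphX ?nD//=.
by apply/coset_id; exact: der_frattini_mem_exp.
Qed.

(** Modulo [der_frattini P] the commutator is central with trivial p-th power. This makes the p-th
    powers of [x] and [y] central, so they can be divided out as well, and the hypothesis says that
    the commutator survives. *)
Lemma heisenberg_quotient x y :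
    P :=: <<[set x; y]>> ->
    (forall i j r, r \in der_frattini P ->
       [~ x, y] <> (x ^+ i) ^+ p * (y ^+ j) ^+ p * r) ->
  exists (rT : finGroupType) (g : gT -> rT),
    {in P &, {morph g : u v / u * v}} /\
    [/\ g x ^+ p = 1, g y ^+ p = 1, [~ g x, g y] != 1,
        commute (g x) [~ g x, g y] & commute (g y) [~ g x, g y]].
Proof.
move=> defP nxy.
have [Px Py] : x \in P /\ y \in P by rewrite defP !mem_gen ?inE ?eqxx ?orbT.
have nDP := normal_norm der_frattini_normal; have nD := subsetP nDP.
have P'xy : [~ x, y] \in P^`(1) by exact: mem_commg.
pose D := der_frattini P; pose a := coset D x; pose b := coset D y.
have Pa : a \in P / D by exact: mem_quotient.
have Pb : b \in P / D by exact: mem_quotient.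
have cab u : u \in P -> commute (coset D u) [~ a, b].
  move=> Pu; rewrite -morphR ?nD//=; apply/commute_sym/commgP.
  rewrite -morphR ?nD ?groupR//=.
  by apply/eqP/coset_id; exact: der_frattini_mem_comm.
have abp : [~ a, b] ^+ p = 1.
  rewrite -morphR ?nD// -morphX ?nD ?groupR//=.
  by apply/coset_id; exact: der_frattini_mem_exp.
have defPD : P / D = <<[set a; b]>>.
  rewrite {1}defP quotient_gen -?defP ?quotientU ?quotient_set1 ?nD//.
  by rewrite subUset !sub1set !nD.
(* For generators [u], [w] one has [u^p, w] = [u, w]^p = 1, since [u, w] commutes with [u]. *)
have cZ u : (u == a) || (u == b) -> u ^+ p \in 'Z(P / D).
  move=> uab; apply/centerP; split.
    by rewrite groupX //; case/orP: uab => /eqP->.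
  move=> w Pw; apply/commute_sym/cent1P; move: w Pw; apply/subsetP; rewrite defPD gen_subG.
  apply/subsetP=> w w_ab; apply/cent1P/commute_sym/commgP.
  have : [~ u, w] ^+ p = 1 /\ commute u [~ u, w].
    have cba u' : u' \in P -> commute (coset D u') [~ b, a].
      by move=> Pu'; rewrite -invgR; apply: commuteV; exact: cab.
    case/orP: uab => /eqP->; case/set2P: w_ab => ->.
    - by rewrite commgg expg1n; split=> //; exact: commute1.
    - by split; [|exact: cab].
    - by rewrite -invgR expgVn abp invg1 invgR; split; [|exact: cba].
    - by rewrite commgg expg1n; split=> //; exact: commute1.
  by case=> uw1 cuw; rewrite commXg // uw1.
pose Z := <[a ^+ p]> <*> <[b ^+ p]>.
have sZ : Z \subset 'Z(P / D) by rewrite join_subG !cycle_subG !cZ ?eqxx ?orbT.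
have nZ : P / D \subset 'N(Z).
  by rewrite cents_norm // centsC (subset_trans sZ) ?subsetIr.
have nZa : a \in 'N(Z) by rewrite (subsetP nZ).
have nZb : b \in 'N(Z) by rewrite (subsetP nZ).
exists (coset_of Z), (fun u => coset Z (coset D u)); split=> [u v Pu Pv|].
  by rewrite !morphM ?nD ?(subsetP nZ) ?mem_quotient.
rewrite -/a -/b.
have gR : [~ coset Z a, coset Z b] = coset Z [~ a, b] by rewrite morphR.
have cR u : u \in P -> commute (coset Z (coset D u)) (coset Z [~ a, b]).
  move=> Pu; rewrite /commute -!morphM ?groupR// ?(subsetP nZ) ?mem_quotient//.
  by rewrite cab.
rewrite gR; split; try exact: cR.
- rewrite -(morphX (coset_morphism Z) p nZa); apply/coset_id/mem_gen.
  by rewrite inE cycle_id.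
- rewrite -(morphX (coset_morphism Z) p nZb); apply/coset_id/mem_gen.
  by rewrite inE cycle_id orbT.
(* A commutator in [Z] would be a product of powers of [a ^+ p] and [b ^+ p]; lifted to [P], this is
   the excluded form. *)
apply/eqP=> /(coset_idr (groupR nZa nZb)).
rewrite /= cent_joinEr; last first.
  have := cZ b; rewrite eqxx orbT => /(_ isT)/setIP[_ bpC].
  by rewrite cycle_subG (subsetP _ _ bpC) // centS // cycle_subG groupX.
case/mulsgP=> _ _ /cycleP[i ->] /cycleP[j ->] abE.
pose v := (x ^+ i) ^+ p * (y ^+ j) ^+ p.
have Pv : v \in P by rewrite groupM // !groupX.
apply: (nxy i j (v^-1 * [~ x, y])); last by rewrite -/v mulKVg.
apply: coset_idr; first by rewrite groupM ?groupV ?groupR ?nD.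
rewrite morphM ?groupV ?groupR ?nD// morphV ?morphR ?nD//= -/a -/b abE.
rewrite /v morphM ?nD ?groupX// !morphX ?nD ?groupX//= -/a -/b.
by rewrite -!expgnA ![(p * _)%N]mulnC mulVg.
Qed.

End DerFrattini.

(** With Z = [X, Y], every element of the generated group has the form X^i Z^k Y^j. If its second
    coordinate is 1, then [p] divides i, k and j, so its first coordinate is 1 too. *)
Lemma heisenberg_pair (gT1 gT2 : finGroupType) (x1 y1 : gT1) (x2 y2 : gT2) :
    prime p ->
    [/\ x1 ^+ p = 1, y1 ^+ p = 1, [~ x1, y1] != 1,
        commute x1 [~ x1, y1] & commute y1 [~ x1, y1]] ->
    [/\ x2 ^+ p = 1, y2 ^+ p = 1, [~ x2, y2] != 1,
        commute x2 [~ x2, y2] & commute y2 [~ x2, y2]] ->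
  ([~ x1, y1], 1 : gT2) \notin <<[set (x1, x2); (y1, y2)]>>.
Proof.
move=> pr_p [x1p y1p k1 cx1 cy1] [x2p y2p k2 cx2 cy2].
have expp (gT : finGroupType) (u : gT) n : u ^+ p = 1 -> p %| n -> u ^+ n = 1.
  by move=> up /dvdnP[m ->]; rewrite mulnC expgnA up expg1n.
set X := (x1, x2); set Y := (y1, y2); set Z := [~ X, Y].
have cXZ : commute X Z by rewrite /commute; congr pair; [exact: cx1 | exact: cx2].
have cYZ : commute Y Z by rewrite /commute; congr pair; [exact: cy1 | exact: cy2].
have sub : <<[set X; Y]>> \subset <[X]> <*> <[Z]> <*> <[Y]>.
  rewrite gen_subG; apply/subsetP=> _ /set2P[]->; apply: mem_gen; rewrite inE.
    by rewrite mem_gen // inE cycle_id.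
  by rewrite cycle_id orbT.
apply/negP=> /(subsetP sub).
have nZ : <[Z]> \subset 'N(<[X]>).
  by rewrite cents_norm // cent_cycle cycle_subG; exact/cent1P/commute_sym.
have nY : <[Y]> \subset 'N(<[X]> <*> <[Z]>).
  have -> : <[X]> <*> <[Z]> = <<[set X; Z]>> by rewrite joing_idl joing_idr.
  rewrite cycle_subG inE -genJ gen_subG conjUg !conjg_set1.
  have -> : X ^ Y = X * Z by rewrite /Z commgEl mulKVg.
  have -> : Z ^ Y = Z by apply/conjg_fixP/commgP; exact: commute_sym.
  have [GX GZ] : X \in <<[set X; Z]>> /\ Z \in <<[set X; Z]>>.
    by split; apply: mem_gen; rewrite !inE eqxx ?orbT.
  by rewrite subUset !sub1set GZ groupM.
have -> : <[X]> <*> <[Z]> <*> <[Y]> = <[X]> * <[Z]> * <[Y]>.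
  by rewrite -(norm_joinEr nZ) -norm_joinEr.
case/mulsgP=> _ _ /mulsgP[_ _ /cycleP[i ->] /cycleP[k ->] ->] /cycleP[j ->].
have pairX (u : gT1) (v : gT2) n : (u, v) ^+ n = (u ^+ n, v ^+ n).
  by elim: n => [//|n IHn]; rewrite !expgS IHn.
rewrite [Z](erefl : Z = ([~ x1, y1], [~ x2, y2])) !pairX.
have dvdp (gT : finGroupType) (u : gT) n :
    u != 1 -> u ^+ p = 1 -> u ^+ n = 1 -> p %| n.
  move=> u1 up un; have /prime_nt_dvdP <- // : #[u] %| p by rewrite order_dvdn up.
    by rewrite order_dvdn un.
  by rewrite order_eq1.
have k2p : [~ x2, y2] ^+ p = 1 by rewrite -commXg // x2p comm1g.
have k1p : [~ x1, y1] ^+ p = 1 by rewrite -commXg // x1p comm1g.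
case=> e1 /esym; rewrite -mulgA => e2.
(* By [e2], [x2 ^+ i] is the inverse of an element commuting with [y2], so [x2, y2]^i = [x2^i, y2] =
   1. *)
have pi : p %| i.
  apply: (dvdp _ _ _ k2 k2p); rewrite -commXg //; apply/eqP/commgP.
  rewrite -[x2 ^+ i]invgK (mulg1_eq e2); apply/commute_sym/commuteV/commuteM.
    by apply: commuteX.
  by apply: commuteX.
(* Now [y2 ^+ j] is inverse to a power of the commutator, hence commutes with [x2]. *)
have pj : p %| j.
  apply: (dvdp _ _ _ k2 k2p); rewrite -commgX //; apply/eqP/commgP.
  have -> : y2 ^+ j = ([~ x2, y2] ^+ k)^-1.
    by move: e2; rewrite (expp _ _ _ x2p pi) mul1g => /mulg1_eq <-.
  by apply/commuteV/commuteX.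
have pk : p %| k.
  apply: (dvdp _ _ _ k2 k2p).
  by move: e2; rewrite (expp _ _ _ x2p pi) (expp _ _ _ y2p pj) mul1g mulg1.
move: e1; rewrite (expp _ _ _ x1p pi) (expp _ _ _ y1p pj) (expp _ _ _ k1p pk).
by rewrite !mulg1 => k1E; rewrite k1E eqxx in k1.
Qed.

(** [L] is the pullback, along the two Heisenberg quotients, of the group generated by the image
    pairs. The p-th power of [x1] becomes trivial there, while [heisenberg_pair] excludes the
    commutator. *)
Lemma heisenberg_separation (gT1 gT2 : finGroupType)
    (P1 : {group gT1}) (P2 : {group gT2}) x1 y1 x2 y2 :
    prime p -> p.-group P1 -> p.-group P2 ->
    P1 :=: <<[set x1; y1]>> -> P2 :=: <<[set x2; y2]>> ->
    (forall i j r, r \in der_frattini P1 ->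
       [~ x1, y1] <> (x1 ^+ i) ^+ p * (y1 ^+ j) ^+ p * r) ->
    (forall i j r, r \in der_frattini P2 ->
       [~ x2, y2] <> (x2 ^+ i) ^+ p * (y2 ^+ j) ^+ p * r) ->
  exists L : {group gT1 * gT2},
    [/\ (x1, x2) \in L, (y1, y2) \in L, (x1 ^+ p, 1) \in L &
        ([~ x1, y1], 1) \notin L].
Proof.
move=> pr_p pP1 pP2 defP1 defP2.
have [Px1 Py1] : x1 \in P1 /\ y1 \in P1 by rewrite defP1 !mem_gen ?inE ?eqxx ?orbT.
have [Px2 Py2] : x2 \in P2 /\ y2 \in P2 by rewrite defP2 !mem_gen ?inE ?eqxx ?orbT.
move=> /(heisenberg_quotient pP1 defP1)[rT1 [g1 [g1M h1]]].
move=> /(heisenberg_quotient pP2 defP2)[rT2 [g2 [g2M h2]]].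
have nL := heisenberg_pair pr_p h1 h2.
have [g11 g21] : g1 1 = 1 /\ g2 1 = 1.
  by split; [apply: (mulgI (g1 1)) | apply: (mulgI (g2 1))];
    rewrite -(g1M, g2M) ?mulg1.
pose L := [set u : gT1 * gT2 | [&& u.1 \in P1, u.2 \in P2 &
  (g1 u.1, g2 u.2) \in <<[set (g1 x1, g2 x2); (g1 y1, g2 y2)]>>]].
have gL : group_set L.
  apply/group_setP; split=> [|u v]; first by rewrite inE /= !group1 g11 g21 group1.
  rewrite !inE => /and3P[u1 u2 u3] /and3P[v1 v2 v3].
  rewrite !groupM ?g1M ?g2M //=.
  exact: (groupM u3 v3).
have g1X n : g1 (x1 ^+ n) = g1 x1 ^+ n.
  by elim: n => [|n IHn]; rewrite ?expg0 // !expgS g1M ?groupX // IHn.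
have g1R : g1 [~ x1, y1] = [~ g1 x1, g1 y1].
  (* Cancelling in y x [x, y] = x y avoids computing the image of an inverse. *)
  apply: (mulgI (g1 y1 * g1 x1)); rewrite -commgC -!g1M ?groupM ?groupR ?groupV //.
  by rewrite -commgC.
exists (Group gL); rewrite !inE /= Px1 Px2 Py1 Py2 groupX // group1 groupR //=.
case: h1 h2 => x1p _ _ _ _ [x2p _ _ _ _].
rewrite g1R g21 g1X x1p nL; split=> //; last exact: group1.
  by rewrite mem_gen ?inE ?eqxx.
by rewrite mem_gen ?inE ?eqxx ?orbT.
Qed.

End FinitePGroups.

(** * Topological groups and their finite quotients *)

Local Open Scope classical_set_scope.
Local Open Scope group_scope.

Section TopGroup.
Variable G : topGroupType.
Implicit Types (A B H K : set G) (x y : G).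

Lemma mulgl_continuous x : continuous (fun y : G => x * y).
Proof.
move=> y; apply: (@continuous2_cvg _ G G G _ _ (fun=> x) id (fun x y => x * y) x y).
- exact: (@mulg_continuous G (x, y)).
- exact: cvg_cst.
- exact: cvg_id.
Qed.

Lemma continuous_mulg (T : topologicalType) (f g : T -> G) :
  continuous f -> continuous g -> continuous (fun t => f t * g t).
Proof.
move=> cf cg t; apply: (@continuous2_cvg _ G G G _ _ f g (fun x y => x * y)).
- exact: (@mulg_continuous G (f t, g t)).
- exact: cf.
- exact: cg.
Qed.

Lemma continuous_expg (T : topologicalType) (f : T -> G) n :
  continuous f -> continuous (fun t => f t ^+ n).
Proof.
move=> cf; elim: n => [|n IHn]; first by move=> t; exact: cvg_cst.
rewrite (_ : (fun t => _) = fun t => f t * f t ^+ n).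
  exact: continuous_mulg.
by apply/funext => t; rewrite expgS.
Qed.

Lemma open_subgroup_nbhs H : is_subgroup H -> nbhs (1 : G) H -> open H.
Proof.
move=> [H1 HM HV] nH; rewrite openE => x Hx.
have : nbhs x ((fun y => x^-1 * y) @^-1` H).
  by apply: (@mulgl_continuous x^-1 x); rewrite mulVg.
by apply: filterS => y /= /(HM _ _ Hx); rewrite mulVKg.
Qed.

Lemma closed_subgroup_gen A : closed_subgroup (closed_gen A).
Proof.
split.
  by apply: closed_bigI => B [[cB _] _].
split=> [|x y Ax Ay|x Ax] B hB; have [[_ [B1 BM BV]] _] := hB => //.
  by apply: BM; [exact: Ax hB | exact: Ay hB].
by apply: BV; exact: Ax hB.
Qed.

Lemma sub_closed_gen A : A `<=` closed_gen A.
Proof. exact: sub_gen_smallest. Qed.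

Lemma closed_gen_sub A K : closed_subgroup K -> A `<=` K -> closed_gen A `<=` K.
Proof. exact: smallest_sub. Qed.

Lemma closed_gen_id K : closed_subgroup K -> closed_gen K = K.
Proof. exact: smallest_id. Qed.

Lemma closed_genS A B : A `<=` B -> closed_gen A `<=` closed_gen B.
Proof.
move=> sAB; apply: closed_gen_sub; first exact: closed_subgroup_gen.
exact: classical_sets.subset_trans sAB (@sub_closed_gen _).
Qed.

Lemma closed_subgroup_derived H : closed_subgroup (derived_subgroup H).
Proof. exact: closed_subgroup_gen. Qed.

Lemma derived_comm H x y : H x -> H y -> derived_subgroup H [~ x, y].
Proof. by move=> Hx Hy; apply: sub_closed_gen; exists x => //; exists y. Qed.

Lemma derivedS H K : H `<=` K -> derived_subgroup H `<=` derived_subgroup K.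
Proof.
move=> sHK; apply: closed_genS => _ [x Hx [y Hy <-]].
by exists x; [exact: sHK | exists y; [exact: sHK|]].
Qed.

Lemma subgroup_expg H x n : is_subgroup H -> H x -> H (x ^+ n).
Proof.
by move=> [H1 HM _] Hx; elim: n => [//|n IHn]; rewrite expgS; exact: HM.
Qed.

Lemma subgroup_comm H x y : is_subgroup H -> H x -> H y -> H [~ x, y].
Proof.
move=> [H1 HM HV] Hx Hy; apply: (HM); first exact: HV.
by apply: (HM); [exact: HV | exact: HM].
Qed.

Lemma derived_sub H : closed_subgroup H -> derived_subgroup H `<=` H.
Proof.
move=> cH; apply: closed_gen_sub => // _ [x Hx [y Hy <-]].
by apply: subgroup_comm => //; case: cH.
Qed.

End TopGroup.

(** * Continuous homomorphisms *)

Section Homomorphism.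
Variables (G G' : topGroupType) (f : G -> G').
Hypotheses (fM : {morph f : x y / x * y}) (fC : continuous f).

Lemma closed_subgroup_preimage K : closed_subgroup K -> closed_subgroup (f @^-1` K).
Proof.
move=> [cK [K1 KM KV]]; split.
  by apply: closed_comp => // x _; exact: fC.
have f1 : f 1 = 1 by apply: (mulgI (f 1)); rewrite -fM !mulg1.
split=> [|x y fx fy|x fx] /=; [by rewrite f1 | by rewrite fM; exact: KM |].
suff -> : f x^-1 = (f x)^-1 by exact: KV.
by apply: (mulgI (f x)); rewrite -fM !mulgV.
Qed.

Lemma closed_gen_morph A B : {homo f : x / A x >-> B x} ->
  {homo f : x / closed_gen A x >-> closed_gen B x}.
Proof.
move=> fAB; apply: closed_gen_sub.
  by apply: closed_subgroup_preimage; exact: closed_subgroup_gen.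
by move=> x /fAB; exact: sub_closed_gen.
Qed.

Lemma morph_expg x n : f (x ^+ n) = f x ^+ n.
Proof.
elim: n => [|n IHn]; last by rewrite !expgS fM IHn.
by apply: (mulgI (f 1)); rewrite expg0 -fM !mulg1.
Qed.

Lemma morph_comm x y : f [~ x, y] = [~ f x, f y].
Proof. by apply: (mulgI (f y * f x)); rewrite -commgC -!fM -commgC. Qed.

Lemma derived_morph H K : {homo f : x / H x >-> K x} ->
  {homo f : x / derived_subgroup H x >-> derived_subgroup K x}.
Proof.
move=> fHK; apply: closed_gen_morph => _ [x Hx [y Hy <-]].
by exists (f x); [exact: fHK | exists (f y); [exact: fHK | rewrite morph_comm]].
Qed.

End Homomorphism.

(* For the discrete topology on [gT], a homomorphism is continuous if and only if
   its kernel is open. *)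
Definition finite_quotient (G : topGroupType) (gT : finGroupType) (f : G -> gT) :=
  {morph f : x y / x * y} /\ open [set x | f x = 1].

(** * Images in finite quotients *)

Section FiniteQuotient.
Variables (G : topGroupType) (gT : finGroupType) (f : G -> gT).
Hypothesis fq : finite_quotient f.
Implicit Types (A H : set G).

Let fM : {morph f : x y / x * y}. Proof. by case: fq. Qed.

Lemma fq1 : f 1 = 1.
Proof. by apply: (mulgI (f 1)); rewrite -fM !mulg1. Qed.

Lemma fqV x : f x^-1 = (f x)^-1.
Proof. by apply: (mulgI (f x)); rewrite -fM !mulgV fq1. Qed.

Lemma fqX x n : f (x ^+ n) = f x ^+ n.
Proof. by elim: n => [|n IHn]; [rewrite !expg0 fq1 | rewrite !expgS fM IHn]. Qed.

Lemma fqR x y : f [~ x, y] = [~ f x, f y].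
Proof. by rewrite !commgEl /conjg !fM !fqV. Qed.

(** The fibre is a translate of the open kernel. *)
Lemma fq_nbhs x : nbhs x [set y | f y = f x].
Proof.
have : nbhs x ((fun y => x^-1 * y) @^-1` [set z | f z = 1]).
  apply: (@mulgl_continuous G x^-1 x); rewrite mulVg.
  by apply: open_nbhs_nbhs; split; [case: fq | exact: fq1].
by apply: filterS => y /=; rewrite fM fqV => /mulg1_eq; rewrite invgK.
Qed.

Lemma fq_preimage_closed (S : set gT) : closed (f @^-1` S).
Proof.
by move=> x /(_ _ (fq_nbhs x))[y [/= Sy fyx]]; rewrite /= -fyx.
Qed.

Lemma fq_preimage_group (K : {group gT}) : closed_subgroup [set x | f x \in K].
Proof.
split; first exact: (@fq_preimage_closed [set y | y \in K]).
split=> [|x y|x] /=; first by rewrite fq1 group1.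
  by rewrite fM => ? ?; exact: groupM.
by rewrite fqV groupV.
Qed.

Definition fimage A : {set gT} := finset (fun y => `[< exists2 x, A x & f x = y >]).

Lemma fimageP A y : reflect (exists2 x, A x & f x = y) (y \in fimage A).
Proof. by rewrite inE; exact: asboolP. Qed.

Lemma mem_fimage A x : A x -> f x \in fimage A.
Proof. by move=> Ax; apply/fimageP; exists x. Qed.

Lemma fimageS A H : A `<=` H -> fimage A \subset fimage H.
Proof. by move=> sAH; apply/subsetP => _ /fimageP[x /sAH Hx <-]; exact: mem_fimage. Qed.

Lemma fimage_group_set H : is_subgroup H -> group_set (fimage H).
Proof.
move=> [H1 HM HV]; apply/group_setP; split; first by rewrite -fq1 mem_fimage.
move=> _ _ /fimageP[x Hx <-] /fimageP[y Hy <-].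
by rewrite -fM; apply: mem_fimage; exact: HM.
Qed.

(** Topological closure disappears in the image: the preimage of the group generated by the image of
    [A] is already a closed subgroup containing [A]. *)
Lemma fimage_gen A : fimage (closed_gen A) = <<fimage A>>.
Proof.
have [_ sA] := @closed_subgroup_gen G A.
apply/eqP; rewrite eqEsubset; apply/andP; split.
  apply/subsetP => _ /fimageP[x Ax <-]; move: x Ax.
  apply: closed_gen_sub; first exact: fq_preimage_group.
  by move=> x Ax; apply/mem_gen; exact: mem_fimage.
rewrite -[fimage (closed_gen A)]/(gval (Group (fimage_group_set sA))) gen_subG.
by apply: fimageS; exact: sub_closed_gen.
Qed.

Lemma fimage_derived H : fimage (derived_subgroup H) = [~: fimage H, fimage H].
Proof.
rewrite fimage_gen; congr <<_>>; apply/setP => y.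
apply/fimageP/imset2P => [[_ [u Hu [v Hv <-]] <-]|].
  by exists (f u) (f v); rewrite ?mem_fimage ?fqR.
case=> _ _ /fimageP[u Hu <-] /fimageP[v Hv <-] ->.
by exists [~ u, v]; [exists u => //; exists v | rewrite fqR].
Qed.

Lemma fimage_set1 x : fimage [set x] = [set f x]%SET.
Proof.
apply/setP => y; rewrite !inE; apply/asboolP/eqP => [[_ -> <-]//|->].
by exists x.
Qed.

Lemma fimageU A H : fimage (A `|` H) = fimage A :|: fimage H.
Proof.
apply/setP => y; apply/fimageP/setUP => [[x [Ax|Hx] <-]|[|] /fimageP[x ? <-]].
- by left; exact: mem_fimage.
- by right; exact: mem_fimage.
- by exists x => //; left.
- by exists x => //; right.
Qed.

End FiniteQuotient.

Lemma finite_quotient_pair (G1 G2 : topGroupType) (gT1 gT2 : finGroupType)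
    (f1 : G1 -> gT1) (f2 : G2 -> gT2) :
  finite_quotient f1 -> finite_quotient f2 ->
  finite_quotient (fun u : (G1 * G2)%type => (f1 u.1, f2 u.2)).
Proof.
move=> fqf1 fqf2; split=> [u v|].
  by case: fqf1 fqf2 => [f1M _] [f2M _]; rewrite /= f1M f2M.
apply: open_subgroup_nbhs.
  split=> [|u v|u] /=; rewrite ?(fq1 fqf1) ?(fq1 fqf2) //.
    case: fqf1 fqf2 => [f1M _] [f2M _] [u1 u2] [v1 v2].
    by rewrite f1M f2M u1 u2 v1 v2 !mulg1.
  by case=> u1 u2; rewrite (fqV fqf1) (fqV fqf2) u1 u2 !invg1.
exists ([set x | f1 x = f1 1], [set y | f2 y = f2 1]); first by split; exact: fq_nbhs.
by move=> [x y] [/= -> ->]; rewrite (fq1 fqf1) (fq1 fqf2).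
Qed.

(** * Approximation of pro-p groups by finite p-groups *)

Section ProP.
Variables (p : nat) (G : proPGroupType p).
Implicit Types (A H K : set G).

(** The normal core of an open subgroup is open: by compactness, one neighbourhood of 1 has all its
    conjugates in [H]. *)
Lemma open_normal_base (U : set G) : nbhs (1 : G) U ->
  exists N : set G, [/\ open N, is_subgroup N, is_normal N & N `<=` U].
Proof.
move=> /prop_open_subgroup_base[H [oH [H1 HM HV] sHU]].
exists [set x | forall y, H (x ^ y)].
have sN : is_subgroup [set x | forall y, H (x ^ y)].
  split=> [y|u v Hu Hv y|u Hu y]; first by rewrite conj1g.
    by rewrite conjMg; exact: HM.
  by rewrite conjVg; exact: HV.
split=> //.
- apply: open_subgroup_nbhs => //.
  (* This is the tube lemma in near-covering form: conjugation sends a neighbourhood of each (y, 1)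
     into [H]. *)
  have : \forall x \near (1 : G), [set: G] `<=` (fun y => H (x ^ y)).
    apply: (iffLR (compact_near_coveringP _) (@prop_compact p G)).
    move=> y _.
    have cJ : continuous (fun u : (G * G)%type => u.2 ^ u.1).
      move=> u; apply: continuous_mulg.
        by move=> v; apply: cvg_comp; [exact: cvg_fst | exact: (@invg_continuous G v.1)].
      by apply: continuous_mulg => v; [exact: cvg_snd | exact: cvg_fst].
    have : nbhs (y, 1 : G) ((fun u : (G * G)%type => u.2 ^ u.1) @^-1` H).
      by apply: cJ; rewrite /= conj1g; apply: open_nbhs_nbhs.
    by [].
  by apply: filterS => x Hx y; exact: Hx.
- by move=> x y Hx z; rewrite -conjgM.
- by move=> x /(_ 1); rewrite conjg1; exact: sHU.
Qed.

(** [G] acts on the p^k left cosets of [N], labelled by a transversal. As [N] is normal, it is both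
    the kernel and the stabilizer of each coset, so the image has order p^k. *)
Lemma open_normal_finite_quotient (N : set G) :
    prime p -> open N -> is_subgroup N -> is_normal N ->
  exists (gT : finGroupType) (f : G -> gT),
    [/\ finite_quotient f, p.-group [set: gT]%SET & forall x, f x = 1 <-> N x].
Proof.
move=> pr_p oN sN nN; have [N1 NM NV] := sN.
have [k /(has_indexP _ sN)[t tS tI]] := @prop_index p G N oN sN nN.
have /choice[idx idxN] : forall x : G, exists i : 'I_(p ^ k), N ((t i)^-1 * x).
  by move=> x; have [i lti Ni] := tS x; exists (Ordinal lti).
have Ndiv (x y z : G) : N (x^-1 * y) -> N (x^-1 * z) -> N (y^-1 * z).
  move=> Nxy Nxz; have := NM _ _ (NV _ Nxy) Nxz.
  by rewrite invgM invgK -!mulgA mulKVg.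
have idxE (x y : G) : idx x = idx y <-> N (x^-1 * y).
  split=> [xy|Nxy]; first by apply: (Ndiv _ _ _ (idxN x)); rewrite xy.
  apply/val_inj/tI; rewrite ?ltn_ord //.
  have := NM _ _ (NM _ _ (idxN x) Nxy) (NV _ (idxN y)).
  by rewrite invgM invgK -!mulgA mulVKg mulKVg.
have idxt (i : 'I_(p ^ k)) : idx (t i) = i.
  by apply/val_inj/tI; rewrite ?ltn_ord //; exact: idxN.
(* The inverse turns the left action into a right one, because products of permutations compose from
   left to right. *)
pose act (g : G) (i : 'I_(p ^ k)) := idx (g^-1 * t i).
have act_inj g : injective (act g).
  move=> i j /idxE; rewrite invgM invgK -mulgA mulKVg => /tI tij.
  by apply/val_inj/tij.
pose f (g : G) : {perm 'I_(p ^ k)} := perm (@act_inj g).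
have fM : {morph f : g h / g * h}.
  move=> g h; apply/permP => i; rewrite permM !permE; apply/idxE.
  have := NV _ (idxN (g^-1 * t i)).
  by rewrite !invgM !invgK -!mulgA mulKVg.
have Nt (g : G) (i : 'I_(p ^ k)) : N (g ^ t i) <-> N g.
  by split=> [/(nN _ (t i)^-1)|]; [rewrite conjgK | exact: nN].
have fN (g : G) : f g = 1 <-> N g.
  split=> [fg1|Ng].
    apply/(Nt _ (idx 1)); have /permP/(_ (idx 1)) := fg1.
    rewrite permE perm1 => gt; have /idxE := etrans gt (esym (idxt (idx 1))).
    by rewrite invgM invgK -mulgA.
  apply/permP => i; rewrite permE perm1 -[RHS]idxt; apply/idxE.
  by rewrite invgM invgK -mulgA; exact: nN.
have fqf : finite_quotient f.
  by split=> //; rewrite (_ : [set x | _] = N) //; apply/seteqP; split=> x /fN.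
have sT : @is_subgroup G [set: G] by [].
pose P := Group (fimage_group_set fqf sT).
have cardP : #|P| = (p ^ k)%N.
  (* Evaluation at the coset of 1 is a bijection from the image onto the labels. *)
  pose i0 := idx 1.
  rewrite -[RHS]card_ord -(@card_in_imset _ _ (fun s : {perm 'I_(p ^ k)} => s i0)).
    apply/eq_card => i; rewrite [RHS]inE; apply/imsetP.
    exists (f (t i0 * (t i)^-1)); first exact: mem_fimage.
    by rewrite permE /act invgM invgK mulgKV idxt.
  move=> _ _ /fimageP[g _ <-] /fimageP[h _ <-]; rewrite !permE => /idxE.
  rewrite invgM invgK -!mulgA [g * _]mulgA => /Nt/fN.
  by rewrite fM (fqV fqf) => /divg1_eq.
have Pf x : f x \in P by exact: mem_fimage.
have subg1 x : subg P (f x) = 1 <-> N x.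
  split=> [/(congr1 val)|/fN ->]; last by rewrite (morph1 (subg_morphism P)).
  by rewrite subgK // => /fN.
(* Restricting the codomain to the image makes the whole finite type a p-group. *)
exists (subg_of P), (fun x => subg P (f x)); split=> //.
  split=> [x y|]; first by rewrite fM subgM.
  by rewrite (_ : [set x | _] = N) //; apply/seteqP; split=> x /subg1.
by rewrite -im_subg morphim_pgroup // /pgroup cardP pnatX pnat_id.
Qed.

Lemma finite_p_quotient_base (U : set G) : prime p -> nbhs (1 : G) U ->
  exists (gT : finGroupType) (f : G -> gT),
    [/\ finite_quotient f, p.-group [set: gT]%SET & forall x, f x = 1 -> U x].
Proof.
move=> pr_p /open_normal_base[N [oN sN nN sNU]].
have [gT [f [fqf pgT fN]]] := open_normal_finite_quotient pr_p oN sN nN.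
by exists gT, f; split=> // x /fN/sNU.
Qed.

(** Take a quotient with kernel inside the translate by [x^-1] of the complement of [C]. If
    [f y = f x] with [y] in [C], then [x^-1 * y] would lie in that kernel. *)
Lemma finite_p_quotient_sep (C : set G) x : prime p -> closed C -> ~ C x ->
  exists (gT : finGroupType) (f : G -> gT),
    [/\ finite_quotient f, p.-group [set: gT]%SET & forall y, C y -> f y <> f x].
Proof.
move=> pr_p cC Cx.
have : nbhs (1 : G) ((fun y => x * y) @^-1` (~` C)).
  apply: (@mulgl_continuous G x); rewrite mulg1.
  by apply: open_nbhs_nbhs; split=> //; exact: closed_openC.
move/(finite_p_quotient_base pr_p) => [gT [f [fqf pgT fU]]].
exists gT, f; split=> // y Cy fyx; case: fqf (fqf) => fM _ fqf.
have /fU : f (x^-1 * y) = 1 by rewrite fM (fqV fqf) fyx mulVg.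
by rewrite /= mulVKg; exact.
Qed.

(** A finite p-quotient separates [x] from a closed set missing it. This is how facts about finite
    p-groups are transferred to [G]. *)
Lemma mem_closed_subgroup H x : prime p -> closed_subgroup H ->
    (forall (gT : finGroupType) (f : G -> gT), finite_quotient f ->
       p.-group [set: gT]%SET -> f x \in fimage f H) ->
  H x.
Proof.
move=> pr_p [cH _] xH; apply: contrapT => /(finite_p_quotient_sep pr_p cH).
move=> [gT [f [fqf pgT]]].
by have /fimageP[y Hy fyx] := xH _ f fqf pgT => /(_ y Hy).
Qed.

Lemma closed_subgroup1 : closed_subgroup [set (1 : G)].
Proof.
split.
  by apply: accessible_closed_set1; apply: hausdorff_accessible; exact: prop_hausdorff.
by split=> // [_ _ -> ->|_ ->]; rewrite ?mulg1 ?invg1.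
Qed.

Lemma eq1_finite_quotients x : prime p ->
    (forall (gT : finGroupType) (f : G -> gT), finite_quotient f ->
       p.-group [set: gT]%SET -> f x = 1) ->
  x = 1.
Proof.
move=> pr_p x1; have [c1 _] := closed_subgroup1.
apply: contrapT => /(finite_p_quotient_sep pr_p c1)[gT [f [fqf pgT fx]]].
by apply: (fx 1) => //; rewrite (x1 _ f) // (fq1 fqf).
Qed.

Lemma compact_image_closed (T : topologicalType) (C : set T) (f : T -> G) :
  compact C -> continuous f -> closed (f @` C).
Proof.
move=> cC fC; apply: compact_closed; first exact: prop_hausdorff.
by apply: continuous_compact => //; apply: continuous_subspaceT.
Qed.

Lemma closed_compact_proP (C : set G) : closed C -> compact C.
Proof. by move=> cC; apply: subclosed_compact (@prop_compact p G) _. Qed.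

End ProP.

(** * Frattini subgroups and resistance *)

Section Frattini.
Variables (p : nat) (G : proPGroupType p).
Hypothesis pr_p : prime p.
Implicit Types (A H K : set G) (x y : G).

Lemma derived_expM H x y n : closed_subgroup H -> H x -> H y ->
  derived_subgroup H ((x ^+ n * y ^+ n)^-1 * (x * y) ^+ n).
Proof.
move=> [_ sH] Hx Hy.
apply: mem_closed_subgroup => //; first exact: closed_subgroup_derived.
move=> gT f fqf _; have [fM _] := fqf.
rewrite fimage_derived // !(fM, fqV fqf, fqX fqf).
by apply: (der1_expM (P := Group (fimage_group_set fqf sH))); exact: mem_fimage.
Qed.

Lemma derived_conj H x y : closed_subgroup H ->
  H y -> derived_subgroup H x -> derived_subgroup H (x ^ y).
Proof.
move=> [_ sH] Hy Dx.
apply: mem_closed_subgroup => //; first exact: closed_subgroup_derived.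
move=> gT f fqf _; have [fM _] := fqf.
have := mem_fimage f Dx; rewrite fimage_derived // => fx.
rewrite /conjg !fM (fqV fqf) -/(conjg (f x) (f y)).
have := der_norm 1 (Group (fimage_group_set fqf sH)).
by move=> /subsetP/(_ (f y) (mem_fimage f Hy)) => /memJ_norm ->.
Qed.

Lemma closed_gen_set1_comm x y z :
  closed_gen [set x] y -> closed_gen [set x] z -> [~ y, z] = 1.
Proof.
move=> xy xz; apply: eq1_finite_quotients => // gT f fqf _.
rewrite (fqR fqf); apply/eqP/commgP.
have := (mem_fimage f xy, mem_fimage f xz); rewrite !fimage_gen // fimage_set1.
by case=> /cycleP[i ->] /cycleP[j ->]; exact: commuteX2.
Qed.

Lemma closed_gen_set1_exp x y n :
  closed_gen [set x] y -> closed_gen [set x ^+ n] (y ^+ n).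
Proof.
move=> xy; apply: mem_closed_subgroup => //; first exact: closed_subgroup_gen.
move=> gT f fqf _.
have := mem_fimage f xy; rewrite !fimage_gen // !fimage_set1 // !(fqX fqf).
by case/cycleP=> i ->; rewrite expgnAC mem_cycle.
Qed.

(** Powers are multiplicative modulo the derived subgroup, which gives a subgroup. It is closed as a
    continuous image of a compact product. *)
Lemma closed_subgroup_expM_derived n K : closed_subgroup K ->
  closed_subgroup [set k ^+ n * d | k in K & d in derived_subgroup K].
Proof.
move=> cK; have [clK sK] := cK; have [K1 KM KV] := sK.
have [clD [D1 DM DV]] := closed_subgroup_derived K.
pose S := [set k ^+ n * d | k in K & d in derived_subgroup K]; rewrite -/S; split.
  have -> : S = (fun u : (G * G)%type => u.1 ^+ n * u.2) @` (K `*` derived_subgroup K).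
    apply/seteqP; split=> [_ [k Kk [d Dd <-]]|_ [[k d] [/= Kk Dd] <-]].
      by exists (k, d).
    by exists k => //; exists d.
  apply: compact_image_closed.
    by apply: compact_setX; exact: closed_compact_proP.
  apply: continuous_mulg => [|u]; last exact: cvg_snd.
  by apply: continuous_expg => u; exact: cvg_fst.
have SP k x : K k -> derived_subgroup K ((k ^+ n)^-1 * x) -> S x.
  by move=> Kk Dx; exists k => //; exists ((k ^+ n)^-1 * x) => //; rewrite mulVKg.
split.
- by exists 1 => //; exists 1 => //; rewrite expg1n mulg1.
- move=> _ _ [k Kk [d Dd <-]] [l Kl [e De <-]].
  apply: (SP (k * l)); first exact: KM.
  (* The first factor is the failure of n-th powers to multiply; the conjugate comes from moving [d]
     past [l ^+ n]. *)
  rewrite (_ : _ * _ = ((k ^+ n * l ^+ n)^-1 * (k * l) ^+ n)^-1 * (d ^ (l ^+ n) * e)).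
    apply: (DM); first by apply: DV; exact: derived_expM.
    by apply: DM => //; apply: derived_conj => //; exact: subgroup_expg.
  by rewrite invgM invgK /conjg !mulgA mulgK.
- move=> _ [k Kk [d Dd <-]]; apply: (SP k^-1); first exact: KV.
  rewrite expVgn invgK invgM mulgA -[_ * _ * _]mulgA.
  rewrite -{1}[k ^+ n]invgK -/(conjg d^-1 (k ^+ n)^-1).
  apply: derived_conj; [done | | exact: DV].
  by apply: KV; exact: subgroup_expg.
Qed.

(** The right-hand side is already a closed subgroup containing the p-th powers and the derived
    subgroup, so closing up adds nothing. *)
Lemma frattiniE K : closed_subgroup K ->
  frattini p K = [set k ^+ p * d | k in K & d in derived_subgroup K].
Proof.
move=> cK; have [clK [K1 _ _]] := cK.
have [_ [D1 _ _]] := closed_subgroup_derived K.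
have [cS [_ SM _]] := closed_subgroup_expM_derived p cK.
apply/seteqP; split; last first.
  move=> _ [k Kk [d Dd <-]]; apply: subset_closure.
  exists (k ^+ p); last by exists d.
  by apply: sub_closed_gen; exists k.
set S := [set _ | _ in K & _ in _] in cS SM *.
have PS : power_subgroup p K `<=` S.
  apply: closed_gen_sub; first exact: closed_subgroup_expM_derived.
  by move=> _ [k Kk <-]; exists k => //; exists 1 => //; rewrite mulg1.
rewrite [S](closure_id _).1 //; apply: closureS => _ [x /PS Sx [d Dd <-]].
by apply: SM => //; exists 1 => //; exists d => //; rewrite expg1n mul1g.
Qed.

Lemma closed_subgroup_frattini K :
  closed_subgroup K -> closed_subgroup (frattini p K).
Proof. by move=> cK; rewrite frattiniE //; exact: closed_subgroup_expM_derived. Qed.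

Lemma frattini_expM K k d : closed_subgroup K ->
  K k -> derived_subgroup K d -> frattini p K (k ^+ p * d).
Proof. by move=> cK Kk Dd; rewrite frattiniE //; exists k => //; exists d. Qed.

Lemma frattini_exp K k : closed_subgroup K -> K k -> frattini p K (k ^+ p).
Proof.
move=> cK Kk; rewrite -[k ^+ p]mulg1; apply: frattini_expM => //.
by case: (closed_subgroup_derived K) => _ [].
Qed.

Lemma frattiniS H K : closed_subgroup H -> closed_subgroup K ->
  H `<=` K -> frattini p H `<=` frattini p K.
Proof.
move=> cH cK sHK x; rewrite frattiniE // => -[k Hk [d Dd <-]].
by apply: frattini_expM => //; [exact: sHK | exact: derivedS Dd].
Qed.

(** Write n = m p^j with [m] prime to [p]. The hypothesis removes the factors [p] one at a time, and
    [m] is harmless in every finite p-quotient. *)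
Lemma root_closed H K : is_subgroup H -> closed_subgroup K ->
    (forall x, H x -> K (x ^+ p) -> K x) ->
  forall x n, H x -> (0 < n)%N -> K (x ^+ n) -> K x.
Proof.
move=> sH cK HK x n Hx /(pfactor_coprime pr_p)[m cpm ->].
rewrite expgnA; elim: (logn p n) => [|j IHj] Kx; last first.
  apply: IHj; apply: HK; last by move: Kx; rewrite expnSr (expgnA (x ^+ m)).
  by do 2!apply: subgroup_expg => //.
apply: mem_closed_subgroup => // gT f fqf pgT.
have Kfx := mem_fimage f Kx; rewrite expg1 (fqX fqf) in Kfx.
have pfx : p.-elt (f x) by rewrite (mem_p_elt pgT) // inE.
have [_ sK] := cK.
exact: (@pgroup_coprime_root _ _ (Group (fimage_group_set fqf sK)) _ _ pfx cpm).
Qed.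

Lemma torsion_free_quotientP H : closed_subgroup H ->
  torsion_free_quotient H (derived_subgroup H) <->
  forall x n, H x -> (0 < n)%N -> derived_subgroup H (x ^+ n) -> derived_subgroup H x.
Proof.
move=> cH; have [_ sD] := closed_subgroup_derived H.
have cosetE x : lcoset_set (derived_subgroup H) x = lcoset_set (derived_subgroup H) 1
    <-> derived_subgroup H x.
  rewrite lcoset_set_eqP // mulg1; case: sD => _ _ DV.
  by split=> /DV; rewrite ?invgK.
by split=> tf x n Hx n0 /cosetE Dx; apply/cosetE; apply: (tf _ n).
Qed.

(* [b = true] restricts a condition to topologically finitely generated
   subgroups, so that both parts of the theorem are handled at once. *)
Definition power_resistant (b : bool) : Prop :=
  forall K, closed_subgroup K -> (b -> top_fg K) ->
  forall x, frattini p K (x ^+ p) -> K x.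

Definition torsion_free_abelianizations (b : bool) : Prop :=
  forall H, closed_subgroup H -> (b -> top_fg H) ->
    torsion_free_quotient H (derived_subgroup H).

(** A procyclic group is abelian, so its Frattini subgroup consists of p-th powers, and these lie in
    the closed subgroup generated by [x ^+ p]. *)
Lemma frattini_closed_gen_set1 K x : closed_subgroup K ->
  frattini p K (x ^+ p) -> frattini p (closed_gen [set x]) `<=` frattini p K.
Proof.
move=> cK Kx; have cx := @closed_subgroup_gen G [set x].
move=> y; rewrite frattiniE // => -[k xk [d Dd <-]].
have -> : d = 1.
  apply: (closed_gen_sub (@closed_subgroup1 p G) _ Dd) => _ [u xu [v xv <-]].
  exact: closed_gen_set1_comm xu xv.
rewrite mulg1; move: (k ^+ p) (@closed_gen_set1_exp x k p xk).
apply: closed_gen_sub; first exact: closed_subgroup_frattini.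
by move=> _ ->.
Qed.

Lemma top_fg_set1 x : top_fg (closed_gen [set x]).
Proof. by exists [set x]. Qed.

(** Resistance need only be tested on procyclic [H], which are finitely generated whatever [b]
    is. *)
Lemma power_resistantP (b : bool) : power_resistant b <->
  forall H K, closed_subgroup H -> closed_subgroup K ->
    (b -> top_fg H) -> (b -> top_fg K) ->
    (frattini p H `<=` frattini p K <-> H `<=` K).
Proof.
split=> [resG H K cH cK fgH fgK|resG K cK fgK x Kx].
  split=> [sHK x Hx|]; last exact: frattiniS.
  by apply: resG => //; apply: sHK; exact: frattini_exp.
have cx := @closed_subgroup_gen G [set x].
have /(resG _ _ cx cK (fun=> top_fg_set1 x) fgK) := frattini_closed_gen_set1 cK Kx.
by apply; exact: sub_closed_gen.
Qed.

Lemma frattini_resistantE : frattini_resistant G <-> power_resistant true.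
Proof.
rewrite power_resistantP.
by split=> res H K cH cK fgH fgK; apply: res => //; [exact: fgH | exact: fgK].
Qed.

Lemma strongly_frattini_resistantE :
  strongly_frattini_resistant G <-> power_resistant false.
Proof. by rewrite power_resistantP; split=> res H K cH cK *; apply: res. Qed.

Lemma power_resistantW (b : bool) : power_resistant b -> power_resistant true.
Proof. by move=> res K cK fgK; apply: res => // _; exact: fgK. Qed.

(** In each finite p-quotient this is [pgroup_mem_der1_nongen]. *)
Lemma closed_gen_derived_nongen K x :
    closed_subgroup K ->
    (exists2 k, K k & derived_subgroup (closed_gen (K `|` [set x])) (k^-1 * x)) ->
  K x.
Proof.
move=> cK [k Kk Dx]; apply: mem_closed_subgroup => // gT f fqf pgT.
have [_ sK] := cK; have [fM _] := fqf.
have [_ sL] := @closed_subgroup_gen G (K `|` [set x]).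
apply: (@pgroup_mem_der1_nongen p _ (Group (fimage_group_set fqf sL))
  (Group (fimage_group_set fqf sK))).
- by rewrite (pgroupS _ pgT) ?subsetT.
- by rewrite /= fimage_gen // fimageU fimage_set1 setUC.
- apply/mulsgP; exists (f k) (f (k^-1 * x)); first exact: mem_fimage.
    by have := mem_fimage f Dx; rewrite fimage_derived.
  by rewrite -fM mulVKg.
Qed.

Lemma torsion_free_abelianizations_resistant (b : bool) :
  torsion_free_abelianizations b -> power_resistant b.
Proof.
move=> tfG K cK fgK x; rewrite frattiniE // => -[k Kk [d Dd kd]].
apply: closed_gen_derived_nongen => //; exists k => //.
set L := closed_gen _; have cL : closed_subgroup L by exact: closed_subgroup_gen.
have sKL : K `<=` L by move=> y Ky; apply: sub_closed_gen; left.
have Lx : L x by apply: sub_closed_gen; right.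
have [_ [_ DM DV]] := closed_subgroup_derived L.
have fgL : b -> top_fg L.
  move=> /fgK[A finA defK]; exists (A `|` [set x]).
    by rewrite finite_setU; split.
  apply/seteqP; split.
    apply: closed_gen_sub; first exact: closed_subgroup_gen.
    move=> y [|->]; last by apply: sub_closed_gen; right.
    by rewrite defK; apply: closed_genS => z; left.
  apply: closed_genS => y [Ay|->]; last by right.
  by left; rewrite defK; exact: sub_closed_gen.
have [_ [_ LM LV]] := cL.
have LkVx : L (k^-1 * x) by apply: LM => //; apply: LV; exact: sKL.
apply: (torsion_free_quotientP cL).1 (tfG L cL fgL) _ p LkVx (prime_gt0 pr_p) _.
(* Modulo the derived subgroup of [L], the p-th power of [k^-1 * x] is k^-p x^p = d, which is
   trivial there. *)
have := derived_expM p cL (LV _ (sKL _ Kk)) Lx.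
rewrite expVgn -kd mulKg => Dkx.
have /DM/(_ Dkx) := derivedS sKL Dd.
by rewrite mulVKg.
Qed.

End Frattini.

(** * Direct products *)

Section Isomorphism.
Variables (p : nat) (G G' : proPGroupType p) (f : G -> G') (g : G' -> G).
Hypotheses (pr_p : prime p) (fM : {morph f : x y / x * y})
  (gM : {morph g : x y / x * y}) (fC : continuous f) (gC : continuous g)
  (fK : cancel f g) (gK : cancel g f).

Let top_fg_preimage (K : set G') : top_fg K -> top_fg (f @^-1` K).
Proof.
move=> [A finA ->]; exists (g @` A); first exact: finite_image.
apply/seteqP; split=> [x fx|].
  rewrite -[x]fK; move: (f x) (fx : closed_gen A (f x)).
  apply: (closed_gen_morph gM gC) => y Ay.
  by exists y.
apply: closed_gen_sub.
  by apply: closed_subgroup_preimage => //; exact: closed_subgroup_gen.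
by move=> _ [y Ay <-]; rewrite /preimage /= gK; exact: sub_closed_gen.
Qed.

Lemma power_resistant_iso (b : bool) :
  power_resistant G b -> power_resistant G' b.
Proof.
move=> resG K cK fgK x; rewrite frattiniE // => -[k Kk [d Dd kd]].
have cfK : closed_subgroup (f @^-1` K) by exact: closed_subgroup_preimage.
rewrite -[x]gK; apply: (resG _ cfK) => [/fgK|]; first exact: top_fg_preimage.
rewrite -(morph_expg gM) -kd gM (morph_expg gM); apply: frattini_expM => //.
  by rewrite /preimage /= gK.
by apply: (derived_morph gM gC) Dd => y Ky; rewrite /preimage /= gK.
Qed.

Lemma torsion_free_abelianizations_iso (b : bool) :
  torsion_free_abelianizations G b -> torsion_free_abelianizations G' b.
Proof.
move=> tfG K cK fgK; apply/torsion_free_quotientP => // x n Kx n0 Dx.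
have cfK : closed_subgroup (f @^-1` K) by exact: closed_subgroup_preimage.
have {}tfG := tfG _ cfK (fun h => top_fg_preimage (fgK h)).
rewrite -[x]gK; apply: (derived_morph fM fC (H := f @^-1` K)) => //.
have gKK y : K y -> (f @^-1` K) (g y) by rewrite /preimage /= gK.
apply: ((torsion_free_quotientP cfK).1 tfG (g x) n (gKK _ Kx) n0).
by rewrite -(morph_expg gM); apply: (derived_morph gM gC) Dx.
Qed.

End Isomorphism.

(** * Products with a torsion-free abelian factor *)

Section Product.
Variables (p : nat) (G1 G2 : proPGroupType p).
Hypothesis pr_p : prime p.
Let G := (G1 * G2)%type.
Implicit Types (H K : set (G1 * G2)%type).

Let fstM : {morph (fst : G -> G1) : u v / u * v}. Proof. by []. Qed.
Let sndM : {morph (snd : G -> G2) : u v / u * v}. Proof. by []. Qed.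
Let fstC : continuous (fst : G -> G1). Proof. by move=> u; exact: cvg_fst. Qed.
Let sndC : continuous (snd : G -> G2). Proof. by move=> u; exact: cvg_snd. Qed.

Lemma mk_pair_sndM : {morph (fun g : G2 => (1, g) : G) : x y / x * y}.
Proof. by move=> x y; rewrite mulg_pairE mulg1. Qed.

Lemma mk_pair_sndC : continuous (fun g : G2 => (1, g) : G).
Proof. by move=> x; apply: cvg_pair; [exact: cvg_cst | exact: cvg_id]. Qed.

Lemma closed_subgroup_snd K : closed_subgroup K -> closed_subgroup (snd @` K).
Proof.
move=> [cK [K1 KM KV]]; split.
  apply: compact_image_closed sndC.
  exact: (@closed_compact_proP p (G1 * G2)%type).
split; first by exists 1.
  by move=> _ _ [u Ku <-] [v Kv <-]; exists (u * v) => //; exact: KM.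
by move=> _ [u Ku <-]; exists u^-1 => //; exact: KV.
Qed.

Lemma snd_closed_gen (A : set G) : snd @` (closed_gen A) = closed_gen (snd @` A).
Proof.
apply/seteqP; split=> [_ [u Au <-]|].
  by move: u Au; apply: (closed_gen_morph sndM sndC) => u Au; exists u.
apply: closed_gen_sub; first by apply: closed_subgroup_snd; exact: closed_subgroup_gen.
by move=> _ [u Au <-]; exists u => //; exact: sub_closed_gen.
Qed.

(** When first coordinates commute, [u, v] = (1, [u.2, v.2]), so embedding the second factor sends
    generating commutators to commutators of [K]. *)
Lemma derived_snd K x : closed_subgroup K ->
    (forall u v, K u -> K v -> [~ u.1, v.1] = 1) ->
  derived_subgroup (snd @` K) x -> derived_subgroup K (1, x).
Proof.
move=> cK cK1; move: x.
apply: (closed_gen_morph mk_pair_sndM mk_pair_sndC).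
move=> _ [_ [u Ku <-] [_ [v Kv <-] <-]]; exists u => //; exists v => //.
by rewrite -(cK1 _ _ Ku Kv).
Qed.

(** The derived subgroup of [H] lies in 1 x G2. Torsion-freeness of [G1] kills the first coordinate
    of a torsion element, and the second is handled in the projection of [H]. *)
Lemma torsion_free_abelianizations_prod (b : bool) :
    abelian_group G1 -> torsion_free_group G1 ->
    torsion_free_abelianizations G2 b ->
  torsion_free_abelianizations (G1 * G2)%type b.
Proof.
move=> abG1 tfG1 tfG2 H cH fgH; apply/torsion_free_quotientP => // x n Hx n0 Dx.
have comm1 u v : [~ u, v] = 1 :> G1 by apply/eqP/commgP; exact: abG1.
have x1 : x.1 = 1.
  apply: (tfG1 _ n) => //; rewrite -(morph_expg fstM).
  move: (x ^+ n) Dx; apply: (@closed_gen_sub _ _ (fst @^-1` [set 1])).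
    by apply: (closed_subgroup_preimage fstM fstC); exact: closed_subgroup1.
  by move=> _ [u _ [v _ <-]]; exact: comm1.
case: x => x1' x2 in Hx Dx x1 *; rewrite /= in x1; subst x1'.
apply: derived_snd => //.
have cH2 := closed_subgroup_snd cH.
have fgH2 : b -> top_fg (snd @` H).
  move=> /fgH[A finA ->]; exists (snd @` A); first exact: finite_image.
  exact: snd_closed_gen.
have Hx2 : (snd @` H) x2 by exists (1, x2).
apply: ((torsion_free_quotientP cH2).1 (tfG2 _ cH2 fgH2) x2 n Hx2 n0).
rewrite -[x2]/(snd (1 : G1, x2)) -(morph_expg sndM).
by apply: (derived_morph sndM sndC) Dx => u Hu; exists u.
Qed.

End Product.

(** * Torsion-freeness and noncommuting pairs *)

Section PowerResistant.
Variables (p : nat) (G : proPGroupType p).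
Hypothesis pr_p : prime p.

Lemma top_fg1 : top_fg [set (1 : G)].
Proof.
exists classical_sets.set0 => //; apply/seteqP; split=> [_ ->|].
  by case: (@closed_subgroup_gen G classical_sets.set0) => _ [].
by apply: closed_gen_sub => //; exact: closed_subgroup1.
Qed.

(** Resistance for the trivial subgroup excludes elements of order [p]; [root_closed] does the
    rest. *)
Lemma power_resistant_torsion_free (b : bool) :
  power_resistant G b -> torsion_free_group G.
Proof.
move=> resG x n n0 xn; have c1 := @closed_subgroup1 p G.
apply: (root_closed (H := [set: G]) (K := [set 1]) pr_p _ c1 _ I n0 xn) => // y _ y1.
apply: (resG _ c1) => [_|]; first exact: top_fg1.
by case: (closed_subgroup_frattini pr_p c1) => _ []; rewrite (y1 : y ^+ p = 1).
Qed.

Lemma derived_sub_frattini (K : set G) : closed_subgroup K ->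
  derived_subgroup K `<=` frattini p K.
Proof.
move=> cK x Dx; rewrite -[x]mul1g -(expg1n G p).
by apply: frattini_expM => //; case: cK => _ [].
Qed.

(** Topological counterpart of [der_frattini]. *)
Definition derived_frattini (H : set G) : set G :=
  closed_gen ([set t ^+ p | t in derived_subgroup H] `|`
              [set [~ t, h] | t in derived_subgroup H & h in H]).

Lemma derived_frattini_sub H : closed_subgroup H ->
  derived_frattini H `<=` derived_subgroup H.
Proof.
move=> cH; have [cD sD] := closed_subgroup_derived H.
apply: closed_gen_sub => // _ [[t Dt <-]|[t Dt [h Hh <-]]].
  exact: (subgroup_expg _ sD).
by apply: derived_comm => //; exact: derived_sub.
Qed.

Lemma fimage_derived_frattini (gT : finGroupType) (f : G -> gT) H :
  finite_quotient f -> fimage f (derived_frattini H) = der_frattini p (fimage f H).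
Proof.
move=> fqf.
have derE : (fimage f H)^`(1) = fimage f (derived_subgroup H).
  by rewrite fimage_derived.
rewrite fimage_gen // fimageU; congr <<_ :|: _>>; apply/setP => y.
  apply/fimageP/imsetP => [[_ [t Dt <-] <-]|[y0 + ->]].
    by exists (f t); [rewrite derE mem_fimage | rewrite (fqX fqf)].
  rewrite derE => /fimageP[t Dt <-].
  by exists (t ^+ p); [exists t | rewrite (fqX fqf)].
apply/fimageP/imset2P => [[_ [t Dt [h Hh <-]] <-]|[y0 z0 + /fimageP[h Hh <-] ->]].
  exists (f t) (f h); [|exact: mem_fimage|by rewrite (fqR fqf)].
  by rewrite derE mem_fimage.
rewrite derE => /fimageP[t Dt <-].
by exists [~ t, h]; [exists t => //; exists h | rewrite (fqR fqf)].
Qed.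

(** The excluded products form the image of the set [M] below. It is compact, hence closed, because
    procyclic closures replace the powers of [a] and [b]; so a finite p-quotient separates it from
    the commutator. *)
Lemma torsion_free_noncommuting_quotient (a b : G) :
    torsion_free_abelianizations G true -> [~ a, b] <> 1 ->
  exists (gT : finGroupType) (f : G -> gT),
    [/\ finite_quotient f, p.-group [set: gT]%SET &
      forall i j r, r \in der_frattini p <<[set f a; f b]%SET>> ->
        [~ f a, f b] <> (f a ^+ i) ^+ p * (f b ^+ j) ^+ p * r].
Proof.
move=> tfG ab1; pose H := closed_gen [set a; b].
have cH : closed_subgroup H by exact: closed_subgroup_gen.
have Ha : H a by apply: sub_closed_gen; left.
have Hb : H b by apply: sub_closed_gen; right.
have fgH : true -> top_fg H by exists [set a; b] => //; exact: finite_set2.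
have tfH := (torsion_free_quotientP cH).1 (tfG H cH fgH).
have HP (gT : finGroupType) (f : G -> gT) : finite_quotient f ->
    fimage f H = <<[set f a; f b]%SET>>.
  by move=> fqf; rewrite fimage_gen // fimageU !fimage_set1.
pose D := derived_frattini H.
have cD : closed_subgroup D by exact: closed_subgroup_gen.
pose M := (fun u : G * G * G => u.1.1 ^+ p * u.1.2 ^+ p * u.2) @`
  (closed_gen [set a] `*` closed_gen [set b] `*` D).
have cM : closed M.
  apply: compact_image_closed.
    apply: compact_setX; last by apply: closed_compact_proP; case: cD.
    by apply: compact_setX; apply: closed_compact_proP;
      exact: (@closed_subgroup_gen G _).1.
  apply: continuous_mulg => [|u]; last exact: cvg_snd.
  apply: continuous_mulg; apply: continuous_expg => u.
    by apply: cvg_comp; [exact: cvg_fst | exact: cvg_fst].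
  by apply: cvg_comp; [exact: cvg_fst | exact: cvg_snd].
have nM : ~ M [~ a, b].
  move=> [[[u v] t] [[/= au bv] Dt] ab]; apply: ab1.
  have sxH (x : G) : H x -> closed_gen [set x] `<=` H.
    by move=> Hx; apply: (closed_gen_sub cH) => _ ->.
  have [Hu Hv] : H u /\ H v by split; [exact: sxH au | exact: sxH bv].
  (* From [a, b] = u^p v^p t, the p-th power of [u * v] is trivial in the torsion-free
     abelianization. Hence v = u^-1 s with [s] in the derived subgroup, as
     [der_frattini_exp_collapse] requires. *)
  have Duv : derived_subgroup H (u * v).
    have [_ [_ HM _]] := cH; have [_ [_ DM DV]] := closed_subgroup_derived H.
    apply: (tfH _ p); [exact: HM | exact: prime_gt0 |].
    rewrite -[_ ^+ p](mulVKg (u ^+ p * v ^+ p)); apply: (DM); last exact: derived_expM.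
    rewrite -[_ * _](mulgK t) ab; apply: DM; first exact: derived_comm.
    by apply: DV; exact: derived_frattini_sub.
  apply: (eq1_finite_quotients pr_p) => gT f fqf pgT; have [fM _] := fqf.
  have defP := HP _ f fqf.
  have sH := cH.2.
  pose P := Group (fimage_group_set fqf sH).
  have pP : p.-group P by rewrite (pgroupS _ pgT) ?subsetT.
  rewrite (fqR fqf).
  apply: (@der_frattini_exp_collapse p _ P pP (f a) (f b) (f u) (f (u * v)) (f t)) => //.
  - exact: mem_fimage.
  - by have := mem_fimage f Duv; rewrite fimage_derived.
  - by have := mem_fimage f Dt; rewrite fimage_derived_frattini.
  - by rewrite fM mulKg -!(fqX fqf) -!fM ab (fqR fqf).
have [gT [f [fqf pgT fM]]] := finite_p_quotient_sep pr_p cM nM.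
exists gT, f; split=> // i j r; rewrite -HP // -fimage_derived_frattini //.
case/fimageP=> t Dt <-; rewrite -!(fqX fqf) -(fqR fqf); case: (fqf) => fMM _.
rewrite -!fMM => /esym; apply: fM; exists (a ^+ i, b ^+ j, t) => //; split=> //.
have sgx (x : G) k : closed_gen [set x] (x ^+ k).
  have [_ sx] := @closed_subgroup_gen G [set x].
  by apply: (subgroup_expg k sx); exact: sub_closed_gen.
by split; exact: sgx.
Qed.

End PowerResistant.

(** * Necessary conditions for a resistant product *)

Section ProductResistant.
Variables (p : nat) (G1 G2 : proPGroupType p).
Hypothesis pr_p : prime p.
Let G := (G1 * G2)%type.

Let fstM : {morph (fst : G -> G1) : u v / u * v}. Proof. by []. Qed.
Let fstC : continuous (fst : G -> G1). Proof. by move=> u; exact: cvg_fst. Qed.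

Lemma pair_expg (x : G1) (y : G2) n : (x, y) ^+ n = (x ^+ n, y ^+ n).
Proof. by elim: n => [//|n IHn]; rewrite !expgS IHn. Qed.

Lemma power_resistant_prod_torsion_free (b : bool) :
  power_resistant (G1 * G2)%type b -> torsion_free_group G1.
Proof.
move=> /(power_resistant_torsion_free pr_p) tfG x n n0 xn.
by have [] : (x, 1) = 1 :> G by apply: (tfG _ n n0); rewrite pair_expg xn expg1n.
Qed.

(** By [root_closed] only p-th roots matter. A counterexample [x] gives a subgroup [K] that contains
    (1, x) by resistance, yet lies over the graph group [L] of a character not killing [x]. *)
Lemma power_resistant_prod_snd (b : bool) :
    nontrivial_group G1 -> power_resistant (G1 * G2)%type b ->
  torsion_free_abelianizations G2 b.
Proof.
move=> [z z1] resG; have tfG1 := power_resistant_prod_torsion_free resG.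
move=> H cH fgH; apply/torsion_free_quotientP => //.
have [cH1 sH] := cH; have cD := closed_subgroup_derived H.
apply: (root_closed pr_p sH cD) => x Hx Dxp; apply: contrapT => Dx.
have [gT2 [f2 [fq2 pgT2 f2D]]] := finite_p_quotient_sep pr_p cD.1 Dx.
pose P := Group (fimage_group_set fq2 sH).
have [|||k [e [eM ex]]] := @pgroup_character_mod p gT2 P (f2 x).
- by rewrite (pgroupS _ pgT2) ?subsetT.
- exact: mem_fimage.
- apply/negP; rewrite (_ : P^`(1) = fimage f2 (derived_subgroup H)).
    by move=> /fimageP[y Dy]; exact: f2D.
  by rewrite fimage_derived.
(* Modulus 1 divides everything, so from here on the modulus is p^(k+1). *)
case: k => [|k] in eM ex; first by rewrite dvd1n in ex.
(* A quotient detecting [z ^+ (p ^ k)], nontrivial by torsion-freeness, gives the image of [z] an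
   order divisible by p^(k+1). *)
have [gT1 [f1 [fqf1 pgT1 f1z]]] : exists (gT : finGroupType) (f : G1 -> gT),
    [/\ finite_quotient f, p.-group [set: gT]%SET & f (z ^+ (p ^ k)) <> 1].
  apply: contrapT => nf; apply/z1/(tfG1 z (p ^ k)%N).
    by rewrite expn_gt0 prime_gt0.
  apply: (eq1_finite_quotients pr_p) => gT f fqf pgT.
  by apply: contrapT => fz; apply: nf; exists gT, f.
have ordz : p ^ k.+1 %| #[f1 z].
  have : p.-elt (f1 z) by rewrite (mem_p_elt pgT1) // inE.
  case/p_natP=> r oz; rewrite oz dvdn_exp2l // ltnNge; apply/negP => ler.
  apply: f1z; rewrite (fqX fqf1); apply/eqP.
  by rewrite -order_dvdn oz dvdn_exp2l.
have [L [eL L1]] := character_graph eM ordz.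
(* Without a finiteness requirement, [H] serves as its own generating set. *)
have [A finA defH] : exists2 A : set G2, (b -> finite_set A) & H = closed_gen A.
  case: (b) fgH => [/(_ isT)[A finA ->]|_]; first by exists A.
  by exists H => //; rewrite closed_gen_id.
pose s a : G := (z ^+ e (f2 a), a).
pose K := closed_gen (s @` A).
have cK : closed_subgroup K by exact: closed_subgroup_gen.
have sndK : snd @` K = H.
  rewrite snd_closed_gen image_comp (_ : snd \o s = id) ?image_id //.
have K1 u v : K u -> K v -> [~ u.1, v.1] = 1.
  suff Kz w : K w -> closed_gen [set z] w.1.
    by move=> /Kz uz /Kz vz; exact: closed_gen_set1_comm uz vz.
  move: w; apply: (@closed_gen_sub _ _ (fst @^-1` closed_gen [set z])).
    by apply: (closed_subgroup_preimage fstM fstC); exact: closed_subgroup_gen.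
  move=> _ [a Aa <-] /=; have [_ sz] := @closed_subgroup_gen G1 [set z].
  by apply: (subgroup_expg _ sz); exact: sub_closed_gen.
(* First coordinates in [K] commute, so its derived subgroup contains 1 x [H, H], and with it the
   p-th power of (1, x). *)
have Kx : K (1, x).
  apply: (resG _ cK) => [bt|].
    by exists (s @` A) => //; apply: finite_image; exact: finA.
  rewrite pair_expg expg1n; apply: derived_sub_frattini => //.
  by apply: derived_snd => //; rewrite sndK.
have KL : K `<=` [set u | (f1 u.1, f2 u.2) \in L].
  apply: closed_gen_sub.
    exact: (fq_preimage_group (finite_quotient_pair fqf1 fq2)).
  move=> _ [a Aa <-] /=; rewrite (fqX fqf1); apply: eL; apply: mem_fimage.
  by rewrite defH; exact: sub_closed_gen.
apply/negP: ex; rewrite negbK; apply: L1.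
by have := KL _ Kx; rewrite /= (fq1 fqf1).
Qed.

Lemma power_resistant_prod_abelian :
    power_resistant (G1 * G2)%type true ->
    torsion_free_abelianizations G1 true -> torsion_free_abelianizations G2 true ->
  abelian_group G1 \/ abelian_group G2.
Proof.
move=> resG tf1 tf2; apply: contrapT => /not_orP[nab1 nab2].
have noncomm (gT : groupType) : ~ abelian_group gT -> exists a b : gT, [~ a, b] <> 1.
  move=> nab; apply: contrapT => nc; apply: nab => a b.
  by apply/commgP/eqP; apply: contrapT => ab; apply: nc; exists a, b.
have [a [b ab]] := noncomm _ nab1; have [c [d cd]] := noncomm _ nab2.
have [gT1 [f1 [fqf1 pgT1 n1]]] := torsion_free_noncommuting_quotient pr_p tf1 ab.
have [gT2 [f2 [fqf2 pgT2 n2]]] := torsion_free_noncommuting_quotient pr_p tf2 cd.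
have [L [Lac Lbd Lap nL]] := @heisenberg_separation p gT1 gT2
  [group of <<[set f1 a; f1 b]%SET>>] [group of <<[set f2 c; f2 d]%SET>>]
  (f1 a) (f1 b) (f2 c) (f2 d) pr_p
  (pgroupS (subsetT _) pgT1) (pgroupS (subsetT _) pgT2)
  erefl erefl n1 n2.
(* The third generator supplies the commutator ([a^p, b], 1). *)
pose A : set G := (a, c) |` ((b, d) |` [set (a ^+ p, 1)]).
pose K := closed_gen A.
have cK : closed_subgroup K by exact: closed_subgroup_gen.
have [_ [_ KM KV]] := cK.
have Kac : K (a, c) by apply: sub_closed_gen; left.
have Kbd : K (b, d) by apply: sub_closed_gen; right; left.
have Kap : K (a ^+ p, 1) by apply: sub_closed_gen; right; right.
have KL : K `<=` [set u | (f1 u.1, f2 u.2) \in L].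
  apply: closed_gen_sub.
    exact: (fq_preimage_group (finite_quotient_pair fqf1 fqf2)).
  by move=> _ [->|[->|->]] //=; rewrite (fqX fqf1) (fq1 fqf2).
have Ky : K (a ^ b, c).
  apply: (resG _ cK) => [_|].
    by exists A => //; rewrite /A !finite_setU; do !split.
  (* In the first coordinate, (a^b)^p = (a^p)^b = a^p [a^p, b]. *)
  have -> : (a ^ b, c) ^+ p = (a, c) ^+ p * [~ (a ^+ p, 1), (b, d)] :> G.
    have -> : [~ (a ^+ p, 1), (b, d)] = ([~ a ^+ p, b], [~ 1, d]) :> G by [].
    by rewrite !pair_expg comm1g mulg_pairE mulg1 commgEl mulKVg conjXg.
  by apply: frattini_expM => //; exact: derived_comm.
have /KL : K ([~ a, b], 1).
  have -> : ([~ a, b], 1) = (a, c)^-1 * (a ^ b, c) :> G.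
    by rewrite invg_pairE mulg_pairE mulVg -commgEl.
  by apply: KM => //; exact: KV.
by rewrite /= (fqR fqf1) (fq1 fqf2); apply/negP.
Qed.

End ProductResistant.

(** * Symmetry of the factors and the final equivalences *)

Section Main.
Variable p : nat.
Hypothesis pr_p : prime p.

Lemma locally_absolutely_torsion_freeE (G : proPGroupType p) :
  locally_absolutely_torsion_free G <-> torsion_free_abelianizations G true.
Proof. by split=> tfG H cH fgH; apply: tfG => //; exact: fgH. Qed.

Lemma absolutely_torsion_freeE (G : proPGroupType p) :
  absolutely_torsion_free G <-> torsion_free_abelianizations G false.
Proof. by split=> tfG H cH *; apply: tfG. Qed.

Let swap (T U : Type) (u : T * U) := (u.2, u.1).

Let swapM (G1 G2 : proPGroupType p) :
  {morph (@swap G1 G2) : u v / (u : G1 * G2) * v >-> (u : G2 * G1) * v}.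
Proof. by []. Qed.

Let swapC (G1 G2 : proPGroupType p) : continuous (@swap G1 G2).
Proof. by move=> u; apply: cvg_pair; [exact: cvg_snd | exact: cvg_fst]. Qed.

Let swapK (T U : Type) : cancel (@swap T U) (@swap U T).
Proof. by case. Qed.

Lemma power_resistant_swap (G1 G2 : proPGroupType p) (b : bool) :
  power_resistant (G1 * G2)%type b -> power_resistant (G2 * G1)%type b.
Proof.
exact: (power_resistant_iso pr_p (@swapM G1 G2) (@swapM G2 G1)
  (@swapC G1 G2) (@swapC G2 G1) (@swapK G1 G2) (@swapK G2 G1)).
Qed.

Lemma torsion_free_abelianizations_swap (G1 G2 : proPGroupType p) (b : bool) :
  torsion_free_abelianizations (G1 * G2)%type b ->
  torsion_free_abelianizations (G2 * G1)%type b.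
Proof.
exact: (torsion_free_abelianizations_iso (@swapM G1 G2) (@swapM G2 G1)
  (@swapC G1 G2) (@swapC G2 G1) (@swapK G1 G2) (@swapK G2 G1)).
Qed.

(** Swapping coordinates gives torsion-free abelianizations for both factors. The abelian
    alternative uses only finitely generated subgroups, so the strong case is first weakened to that
    one. *)
Lemma power_resistant_prodP (G1 G2 : proPGroupType p) (b : bool) :
    nontrivial_group G1 -> nontrivial_group G2 ->
  (power_resistant (G1 * G2)%type b <->
    (abelian_group G1 /\ torsion_free_group G1 /\ torsion_free_abelianizations G2 b) \/
    (abelian_group G2 /\ torsion_free_group G2 /\ torsion_free_abelianizations G1 b)) /\
  (power_resistant (G1 * G2)%type b -> torsion_free_abelianizations (G1 * G2)%type b).
Proof.
move=> nt1 nt2.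
set R := _ \/ _.
have RtfG : R -> torsion_free_abelianizations (G1 * G2)%type b.
  move=> [[ab [tf tfG]]|[ab [tf tfG]]]; first exact: torsion_free_abelianizations_prod.
  by apply: torsion_free_abelianizations_swap; exact: torsion_free_abelianizations_prod.
have resR : power_resistant (G1 * G2)%type b -> R.
  move=> res; have res' := power_resistant_swap res.
  have tf2 := power_resistant_prod_snd pr_p nt1 res.
  have tf1 := power_resistant_prod_snd pr_p nt2 res'.
  have tft (G : proPGroupType p) :
      torsion_free_abelianizations G b -> torsion_free_abelianizations G true.
    by move=> tf H cH fgH; apply: tf => // _; exact: fgH.
  have [ab|ab] := power_resistant_prod_abelian pr_p (power_resistantW res)
    (tft _ tf1) (tft _ tf2).
    by left; split=> //; split=> //; exact: power_resistant_prod_torsion_free res.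
  by right; split=> //; split=> //; exact: power_resistant_prod_torsion_free res'.
split; last by move=> /resR/RtfG.
by split=> // /RtfG; exact: torsion_free_abelianizations_resistant.
Qed.

End Main.

Theorem theorem1 (p : nat) (hp : prime p) (G1 G2 : proPGroupType p)
    (hG1 : nontrivial_group G1) (hG2 : nontrivial_group G2) :
  ((frattini_resistant (G1 * G2)%type <->
      (abelian_group G1 /\ torsion_free_group G1 /\
         locally_absolutely_torsion_free G2) \/
      (abelian_group G2 /\ torsion_free_group G2 /\
         locally_absolutely_torsion_free G1)) /\
   (frattini_resistant (G1 * G2)%type ->
      locally_absolutely_torsion_free (G1 * G2)%type))
  /\
  ((strongly_frattini_resistant (G1 * G2)%type <->
      (abelian_group G1 /\ torsion_free_group G1 /\
         absolutely_torsion_free G2) \/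
      (abelian_group G2 /\ torsion_free_group G2 /\
         absolutely_torsion_free G1)) /\
   (strongly_frattini_resistant (G1 * G2)%type ->
      absolutely_torsion_free (G1 * G2)%type)).
Proof.
rewrite frattini_resistantE // strongly_frattini_resistantE //.
rewrite !locally_absolutely_torsion_freeE !absolutely_torsion_freeE.
by split; exact: power_resistant_prodP.
Qed.
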